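(* Let $\mathcal{T}$ be a topologically mixing random group extension of a random shift of finite type $f$ by a countable group $G$. Suppose that $\varphi:\mathcal{E}\rightarrow\mathbb{R}$ is a locally fiber Hölder continuous function satisfying $$\int_{\Omega}\|\varphi(\omega,\cdot)\|_{\infty}\,d\mathbb{P}(\omega)<\infty \quad\text{and}\quad \int_{\Omega}\left|\log\|\mathcal{L}_{\varphi}^{\omega}\mathbf{1}\|_{\infty}\right|d\mathbb{P}(\omega)<\infty .$$ If $G$ is amenable, then $$\Pi_{Gur}^{(r)}(\mathcal{T},\tilde{\varphi})=\Pi_{Gur}^{(r)}(\mathcal{T}_{\rm ab},\tilde{\varphi}_{\rm ab}).$$
   Context: **Random shift.** $(\Omega,\mathcal{F},\mathbb{P})$ is a probability space and $\vartheta:\Omega\to\Omega$ an ergodic invertible $\mathbb{P}$-preserving transformation. $l$ is an $\mathbb{N}\cup\{\infty\}$-valued random variable with $l(\omega)>1$; $S(\omega)=\{j\in\mathbb{N}:j<l(\omega)\}$; $A_\omega=(\alpha_{i,j}(\omega))_{i\in S(\omega),j\in S(\vartheta\omega)}$ are matrices with entries in $\{0,1\}$ depending measurably on $\omega$. Put $\mathcal{E}_\omega=\{x=(x_0,x_1,\ldots):x_i\in S(\vartheta^i\omega),\ \alpha_{x_i,x_{i+1}}(\vartheta^i\omega)=1\ \forall i\ge 0\}$, assumed nonempty for a.e. $\omega$; $f_\omega:\mathcal{E}_\omega\to\mathcal{E}_{\vartheta\omega}$ is the left shift, $f=(f_\omega)_{\omega\in\Omega}$, $\mathcal{E}=\{(\omega,x):\omega\in\Omega,x\in\mathcal{E}_\omega\}$,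 $\Theta(\omega,x)=(\vartheta\omega,f_\omega x)$. Such $f$ is a random countable Markov shift. $f$ is a random shift of finite type if $l$ is $\mathbb{N}$-valued and $\int_\Omega\log l\,d\mathbb{P}<\infty$. **Words.** A word $(x_0,\ldots,x_{n-1})\in\mathbb{N}^n$ is $\omega$-admissible if $x_i<l(\vartheta^i\omega)$ for $0\le i\le n-1$ and $\alpha_{x_i,x_{i+1}}(\vartheta^i\omega)=1$ for $0\le i\le n-2$; $\mathcal{W}^n(\omega)$ is the set of such words; $[x_0,\ldots,x_{n-1}]_\omega=\{y\in\mathcal{E}_\omega:y_i=x_i,\ 0\le i\le n-1\}$. For a letter $a$, $\Omega_a=\{\omega:[a]_\omega\ne\emptyset\}$; $\mathcal{W}^1$ is the set of letters $a$ with $\mathbb{P}(\Omega_a)>0$. For letters $a,b$, $\mathcal{W}^n_{a,b}(\omega)$ is the set of $(x_0,\ldots,x_{n-1})\in\mathcal{W}^n(\omega)$ with $x_0=a$ and $x_{n-1}b$ being $\vartheta^{n-1}\omega$-admissible. $f$ is topologically mixing if for all $a,b\in\mathcal{W}^1$ there is $N_{ab}\in\mathbb{N}$ such that for a.e. $\omega$ and all $n\ge N_{ab}$ with $a\in S(\omega)$, $b\in S(\vartheta^n\omega)$ one has $\mathcal{W}^n_{a,b}(\omega)\neq\emptyset$. Throughout, $f$ is assumed topologically mixing. **Potentials.** $V_n^\omega(\varphi)=\sup\{|\varphi(\omega,x)-\varphi(\omega,y)|:x,y\in\mathcal{E}_\omega,\ x_i=y_i,\ 0\le i\le n-1\}$.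 $\varphi$ is locally fiber Hölder continuous if there is a random variable $\kappa:\Omega\to\mathbb{N}$, $\kappa\ge1$, $\int\kappa\,d\mathbb{P}<\infty$, with $V_n^\omega(\varphi)\le\kappa(\omega)2^{-n}$ for a.e. $\omega$ and all $n\ge1$. The random Perron–Frobenius operator is $\mathcal{L}_\varphi^\omega\phi(\vartheta\omega,x)=\sum_{y\in\mathcal{E}_\omega,f_\omega y=x}e^{\varphi(\omega,y)}\phi(\omega,y)$. $\|\cdot\|_\infty$ denotes the supremum norm over the fiber. **Random group extension.** Let $\psi:\mathbb{N}^{\mathbb{N}}\to G$ depend only on the coordinate $x_0$, and let $\psi_\omega=\psi|_{\mathcal{E}_\omega}$. The random group extension is $\mathcal{T}=(\mathcal{T}_\omega)$, $\mathcal{T}_\omega:\mathcal{E}_\omega\times G\to\mathcal{E}_{\vartheta\omega}\times G$, $\mathcal{T}_\omega(x,g)=(f_\omega x,g\psi_\omega(x))$. Write $\psi_\omega^n(x)=\psi_\omega(x)\psi_{\vartheta\omega}(f_\omega x)\cdots\psi_{\vartheta^{n-1}\omega}(f_\omega^{n-1}x)$, which depends only on $(x_0,\dots,x_{n-1})$, so $\psi_\omega^n(\alpha)$ makes sense for $\alpha\in\mathcal{W}^n(\omega)$. $\mathcal{T}$ is topologically mixing if for all $a,b\in\mathcal{W}^1$, $g\in G$ there is $N$ such that for a.e. $\omega$ and all $n\ge N$ with $a\in S(\omega)$, $b\in S(\vartheta^n\omega)$, there is $\alpha\in\mathcal{W}^n(\omega)$ with $[\alpha]_\omega\subset[a]_\omega$,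 $f_\omega^n([\alpha]_\omega)\supset[b]_{\vartheta^n\omega}$ and $\psi^n_\omega(\alpha)=g$. Put $\tilde\varphi(\omega,x,g)=\varphi(\omega,x)$ on $\mathcal{E}\times G$. **Abelianization.** $G^{\rm ab}=G/[G,G]$ (identity written $0$), $\pi:G\to G^{\rm ab}$ the projection, $\psi_{{\rm ab},\omega}=\pi\circ\psi_\omega$, $\psi^n_{{\rm ab},\omega}=\pi\circ\psi^n_\omega$, $\mathcal{T}_{{\rm ab},\omega}(x,g)=(f_\omega x,g\,\psi_{{\rm ab},\omega}(x))$ on $\mathcal{E}_\omega\times G^{\rm ab}$, and $\tilde\varphi_{\rm ab}(\omega,x,g)=\varphi(\omega,x)$ on $\mathcal{E}\times G^{\rm ab}$. **Relative Gurevič pressure.** For $a\in\mathcal{W}^1$ let $n_a^{(0)}(\omega)=0$ and $n_a^{(k+1)}(\omega)=\min\{n>n_a^{(k)}(\omega):\vartheta^n\omega\in\Omega_a\}$. Set $$\tilde Z_n^\omega(\tilde\varphi,a,a)=\sum_{\alpha\in\mathcal{W}^n_{a,a}(\omega),\ \psi_\omega^n(\alpha)=id}\exp\Big(\sup_{y\in[\alpha]_\omega}\sum_{i=0}^{n-1}\varphi\circ\Theta^i(\omega,y)\Big),$$ and define $\tilde Z_{{\rm ab},n}^\omega(\tilde\varphi_{\rm ab},a,a)$ in the same way with the condition $\psi_\omega^n(\alpha)=id$ replaced by $\psi^n_{{\rm ab},\omega}(\alpha)=0$. Then $\Pi_{Gur}^{(r)}(\mathcal{T},\tilde\varphi)$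 is the value of $\lim_{j\to\infty}\frac{1}{n_a^{(j)}(\omega)}\log\tilde Z^\omega_{n_a^{(j)}(\omega)}(\tilde\varphi,a,a)$, and $\Pi_{Gur}^{(r)}(\mathcal{T}_{\rm ab},\tilde\varphi_{\rm ab})$ is the same limit with $\tilde Z_{\rm ab}$; these limits exist, are constant for a.e. $\omega\in\Omega_a$, and do not depend on $a$. *)

(* Defs.v *)
From HB Require Import structures.
From mathcomp Require Import all_boot all_order all_algebra.
From mathcomp Require Import all_classical all_reals all_analysis.
Import Order.TTheory GRing.Theory Num.Theory.
Import numFieldNormedType.Exports.

Set Implicit Arguments.
Unset Strict Implicit.
Unset Printing Implicit Defensive.

Local Open Scope classical_set_scope.

Definition is_subgroup (G : groupType) (H : set G) : Prop :=
  [/\ H 1%g, forall x y, H x -> H y -> H (x * y)%g & forall x, H x -> H (x^-1)%g].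

Definition commutator_subgroup (G : groupType) : set G :=
  \bigcap_(H in [set H : set G | is_subgroup H /\ forall x y, H (commg x y)]) H.

Lemma commutator_subgroupP (G : groupType) : is_subgroup (@commutator_subgroup G).
Proof.
split.
- by move=> H [[]].
- by move=> x y Cx Cy H HP; case: (HP) => -[_ HM _] _; apply: HM; [exact: Cx|exact: Cy].
- by move=> x Cx H HP; case: (HP) => -[_ _ HV] _; apply: HV; exact: Cx.
Qed.

Lemma commutator_subgroupR (G : groupType) (x y : G) :
  commutator_subgroup (commg x y).
Proof. by move=> H [_]; apply. Qed.

Lemma commutator_subgroupJ (G : groupType) (x y : G) :
  commutator_subgroup x -> commutator_subgroup (x ^ y)%g.
Proof.
have [_ CM _] := commutator_subgroupP G.
have -> : (x ^ y = x * commg x y)%g by rewrite /commg mulgA mulgV mul1g.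
by move=> Cx; apply: CM => //; exact: commutator_subgroupR.
Qed.

Section Abelianization.
Variable G : groupType.

Definition ab_rel (x y : G) : bool := `[< commutator_subgroup (x^-1 * y)%g >].

Lemma ab_rel_refl : reflexive ab_rel.
Proof. by move=> x; apply/asboolP; rewrite mulVg; case: (commutator_subgroupP G). Qed.

Lemma ab_rel_sym : symmetric ab_rel.
Proof.
have [_ _ CV] := commutator_subgroupP G.
by move=> x y; apply/asboolP/asboolP => /CV; rewrite invgM invgK.
Qed.

Lemma ab_rel_trans : transitive ab_rel.
Proof.
have [_ CM _] := commutator_subgroupP G.
move=> y x z /asboolP xy /asboolP yz; apply/asboolP.
by have := CM _ _ xy yz; rewrite mulgA mulgK.
Qed.

Canonical ab_equiv := EquivRel ab_rel ab_rel_refl ab_rel_sym ab_rel_trans.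

Definition abelianization := {eq_quot ab_equiv}%qT.

HB.instance Definition _ := Choice.on abelianization.
HB.instance Definition _ := EqQuotient.on abelianization.

Definition ab_proj (x : G) : abelianization := (\pi_abelianization x)%qT.

Definition ab_one : abelianization := ab_proj 1%g.
Definition ab_inv (u : abelianization) : abelianization := ab_proj (repr u)^-1%g.
Definition ab_mul (u v : abelianization) : abelianization :=
  ab_proj (repr u * repr v)%g.

Lemma ab_projP (x y : G) :
  ab_proj x = ab_proj y <-> commutator_subgroup (x^-1 * y)%g.
Proof. by split=> [/eqmodP/asboolP//|h]; apply/eqmodP/asboolP. Qed.

Lemma ab_reprK (u : abelianization) : ab_proj (repr u) = u.
Proof. exact: reprK. Qed.

Lemma ab_mulE (x y : G) : ab_mul (ab_proj x) (ab_proj y) = ab_proj (x * y)%g.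
Proof.
rewrite /ab_mul; set x' := repr _; set y' := repr _.
have /ab_projP xx' : ab_proj x' = ab_proj x by rewrite ab_reprK.
have /ab_projP yy' : ab_proj y' = ab_proj y by rewrite ab_reprK.
apply/ab_projP; have [_ CM _] := commutator_subgroupP G.
have -> : ((x' * y')^-1 * (x * y) = (x'^-1 * x) ^ y' * (y'^-1 * y))%g.
  by rewrite /conjg invgM !mulgA mulgK.
by apply: CM => //; apply: commutator_subgroupJ.
Qed.

Lemma ab_invE (x : G) : ab_inv (ab_proj x) = ab_proj (x^-1)%g.
Proof.
rewrite /ab_inv; set x' := repr _.
have /ab_projP xx' : ab_proj x = ab_proj x' by rewrite ab_reprK.
apply/ab_projP; rewrite invgK.
have -> : (x' * x^-1 = (x^-1 * x') ^ (x^-1))%g.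
  by rewrite /conjg invgK !mulgA mulgV mul1g.
exact: commutator_subgroupJ.
Qed.

Lemma ab_mulA : associative ab_mul.
Proof.
by move=> u v w; rewrite -(ab_reprK u) -(ab_reprK v) -(ab_reprK w) !ab_mulE mulgA.
Qed.
Lemma ab_mul1 : left_id ab_one ab_mul.
Proof. by move=> u; rewrite -(ab_reprK u) ab_mulE mul1g. Qed.
Lemma ab_mulr1 : right_id ab_one ab_mul.
Proof. by move=> u; rewrite -(ab_reprK u) ab_mulE mulg1. Qed.
Lemma ab_mulV : left_inverse ab_one ab_inv ab_mul.
Proof. by move=> u; rewrite -(ab_reprK u) ab_invE ab_mulE mulVg. Qed.
Lemma ab_mulrV : right_inverse ab_one ab_inv ab_mul.
Proof. by move=> u; rewrite -(ab_reprK u) ab_invE ab_mulE mulgV. Qed.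

HB.instance Definition _ := isGroup.Build abelianization
  ab_mulA ab_mul1 ab_mulr1 ab_mulV ab_mulrV.

End Abelianization.

Local Open Scope ring_scope.

(** Amenability of a discrete group: a left-invariant mean on the bounded
    real functions. [m] is total, but only its restriction to the bounded
    functions is constrained. *)
Definition bounded_real (R : realType) (T : Type) (f : T -> R) : Prop :=
  exists M : R, forall x, `|f x| <= M.

Definition invariant_mean (R : realType) (G : groupType) (m : (G -> R) -> R) : Prop :=
  [/\ forall (c : R) f g, bounded_real f -> bounded_real g ->
        m (fun x => c * f x + g x) = c * m f + m g,
      forall f, bounded_real f -> (forall x, 0 <= f x) -> 0 <= m f,
      m (fun=> 1) = 1
    & forall (h : G) f, bounded_real f -> m (fun x => f (h * x)%g) = m f].

Definition amenable (R : realType) (G : groupType) : Prop :=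
  exists m : (G -> R) -> R, invariant_mean m.

(** The set of letters is [nat] (so 0 is a letter), and
    [transition X w i j] is the matrix entry alpha_{i,j}(w); its values are only
    relevant for i < l(w) and j < l(theta w). *)
Record shift_data (T : Type) := ShiftData {
  base_map : T -> T;
  nletters : T -> nat;
  transition : T -> nat -> nat -> bool
}.

Definition left_shift (x : nat -> nat) : nat -> nat := fun i => x i.+1.

(** [nat -> nat] with its product sigma-algebra, generated by the sets
    {x | x_n = j}. *)
Definition coordinate_sets : set (set (nat -> nat)) :=
  [set C | exists n j, C = [set x | x n = j]].

Definition sequences := g_sigma_algebraType coordinate_sets.

Section Shift.
Context (T : Type) (X : shift_data T).
Local Notation theta := (base_map X).

Definition fiber (w : T) : set (nat -> nat) :=
  [set x | forall i,
     (x i < nletters X (iter i theta w))%N /\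
     transition X (iter i theta w) (x i) (x i.+1)].

Definition total_space : set (T * (nat -> nat)) := [set p | fiber p.1 p.2].

Definition Theta (p : T * (nat -> nat)) : T * (nat -> nat) :=
  (theta p.1, left_shift p.2).

Definition admissible (w : T) (u : seq nat) : Prop :=
  (forall i, (i < size u)%N -> (nth 0%N u i < nletters X (iter i theta w))%N) /\
  (forall i, (i.+1 < size u)%N ->
     transition X (iter i theta w) (nth 0%N u i) (nth 0%N u i.+1)).

Definition words (n : nat) (w : T) : set (seq nat) :=
  [set u | size u = n /\ admissible w u].

Definition cylinder (w : T) (u : seq nat) : set (nat -> nat) :=
  [set y | fiber w y /\ forall i, (i < size u)%N -> y i = nth 0%N u i].

(** [words_from_to n a b w] is W^n_{a,b}(w), for n >= 1. *)
Definition words_from_to (n : nat) (a b : nat) (w : T) : set (seq nat) :=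
  [set u | [/\ words n w u, ohead u = Some a
             & admissible (iter n.-1 theta w) [:: last a u; b]]].

Definition letter_set (a : nat) : set T := [set w | cylinder w [:: a] !=set0].

Definition is_min_nat (A : set nat) (n : nat) : Prop :=
  A n /\ forall k, A k -> (n <= k)%N.

(** [get] picks the minimum when the set of later visits is nonempty and is
    arbitrary otherwise; by Poincare recurrence the latter does not occur for
    a.e. w in [letter_set a]. *)
Definition visit_time (a : nat) (w : T) (k : nat) : nat :=
  iter k (fun m => get (is_min_nat
    [set n | (m < n)%N /\ letter_set a (iter n theta w)])) 0%N.

End Shift.

Section RandomShift.
Context (R : realType) (d : measure_display) (T : measurableType d).
Context (P : probability T R) (X : shift_data T).
Local Notation theta := (base_map X).

Definition invertible_measure_preserving (f : T -> T) : Prop :=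
  [/\ measurable_fun [set: T] f,
      exists g : T -> T, [/\ measurable_fun [set: T] g, cancel f g & cancel g f]
    & forall A, measurable A -> P (f @^-1` A) = P A].

Definition ergodic (f : T -> T) : Prop :=
  forall A, measurable A -> f @^-1` A = A -> P A = 0%E \/ P A = 1%E.

Record random_shift_of_finite_type : Prop := {
  base_invertible : invertible_measure_preserving theta;
  base_ergodic : ergodic theta;
  nletters_measurable : measurable_fun [set: T] (nletters X);
  nletters_gt1 : forall w, (1 < nletters X w)%N;
  trans_measurable : forall i j, measurable_fun
    [set w | (i < nletters X w)%N /\ (j < nletters X (theta w))%N]
    (fun w => transition X w i j);
  fiber_nonempty : {ae P, forall w, fiber X w !=set0};
  log_nletters_integrable :
    (\int[P]_w (ln (nletters X w)%:R)%:E < +oo)%E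
}.

Definition essential_letter (a : nat) : Prop := (0 < P (letter_set X a))%E.

Definition shift_mixing : Prop :=
  forall a b, essential_letter a -> essential_letter b ->
  exists N : nat, {ae P, forall w, forall n, (N <= n)%N ->
    (a < nletters X w)%N -> (b < nletters X (iter n theta w))%N ->
    words_from_to X n a b w !=set0}.

(** A potential is a function on [T * (nat -> nat)], of which only
    the restriction to [total_space X] is ever used. Suprema are taken in the
    extended reals, so that unbounded fibers are not given junk values. *)

Definition fiber_variation (n : nat) (phi : T * (nat -> nat) -> R) (w : T) : \bar R :=
  ereal_sup [set z | exists x y, [/\ fiber X w x, fiber X w y,
    (forall i, (i < n)%N -> x i = y i) & z = `|phi (w, x) - phi (w, y)|%:E]].

Definition locally_fiber_Holder (phi : T * (nat -> nat) -> R) : Prop :=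
  exists kappa : T -> nat,
  [/\ measurable_fun [set: T] kappa,
      forall w, (1 <= kappa w)%N,
      (\int[P]_w ((kappa w)%:R)%:E < +oo)%E
    & {ae P, forall w, forall n, (1 <= n)%N ->
        (fiber_variation n phi w <= ((kappa w)%:R * 2 ^- n)%:E)%E}].

Definition fiber_sup_norm (h : T * (nat -> nat) -> R) (w : T) : \bar R :=
  ereal_sup [set `|h (w, x)|%:E | x in fiber X w].

(** [transfer phi w h x] is (L_phi^w h)(theta w, x). The sum is
    meaningful for a finite set of preimages only: over a shift of finite
    type a point has at most l(w) preimages. *)
Definition transfer (phi : T * (nat -> nat) -> R) (w : T)
    (h : T * (nat -> nat) -> R) (x : nat -> nat) : R :=
  \sum_(y \in [set y | fiber X w y /\ left_shift y = x])
    (expR (phi (w, y)) * h (w, y)).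

(** The supremum norm of L_phi^w 1, taken over the fiber over theta w. *)
Definition transfer_one_norm (phi : T * (nat -> nat) -> R) (w : T) : \bar R :=
  ereal_sup [set `|transfer phi w (fun=> 1) x|%:E | x in fiber X (theta w)].

Definition birkhoff_sum (phi : T * (nat -> nat) -> R) (n : nat)
    (w : T) (y : nat -> nat) : R :=
  \sum_(i < n) phi (iter i (Theta X) (w, y)).

(** The fiber map psi_w is the restriction of psi to [fiber X w]. *)
Section Extension.
Context (G : groupType) (psi : (nat -> nat) -> G).

Definition depends_on_first_coordinate : Prop :=
  forall x y : nat -> nat, x 0%N = y 0%N -> psi x = psi y.

(** The product is ordered: psi(x) psi(f x) ... psi(f^{n-1} x). *)
Definition cocycle (n : nat) (x : nat -> nat) : G :=
  (\prod_(i < n) psi (iter i left_shift x))%g.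

(** If psi depends only on x_0, then [cocycle n x] depends only on
    x_0, ..., x_{n-1}, so that the padding of the word u by zeros is
    irrelevant. *)
Definition cocycle_word (u : seq nat) : G := cocycle (size u) (nth 0%N u).

Definition extension_mixing : Prop :=
  forall a b (g : G), essential_letter a -> essential_letter b ->
  exists N : nat, {ae P, forall w, forall n, (N <= n)%N ->
    (a < nletters X w)%N -> (b < nletters X (iter n theta w))%N ->
    exists u, [/\ words X n w u,
      cylinder X w u `<=` cylinder X w [:: a],
      cylinder X (iter n theta w) [:: b] `<=` iter n left_shift @` cylinder X w u
    & cocycle_word u = g]}.

(** The sum over words, with exp(-oo) = 0 for a word with an empty cylinder. *)
Definition partition_sum (phi : T * (nat -> nat) -> R) (n : nat) (a : nat)
    (w : T) : \bar R :=
  \esum_(u in words_from_to X n a a w `&` [set u | cocycle_word u = 1%g])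
    expeR (ereal_sup [set (birkhoff_sum phi n w y)%:E | y in cylinder X w u]).

(** [p] is the relative Gurevic pressure of the extension by psi of the lift
    of phi: for every essential letter a, p is the a.e. constant value on
    Omega_a of the limit along the visit times to Omega_a. Here [lne] is the
    logarithm with [lne 0 = -oo], so an empty sum is not counted as 1. *)
Definition is_relative_Gurevic_pressure (phi : T * (nat -> nat) -> R)
    (p : \bar R) : Prop :=
  forall a, essential_letter a ->
  {ae P, forall w, letter_set X a w ->
    ((fun j : nat => ((visit_time X a w j)%:R^-1)%:E *
        lne (partition_sum phi (visit_time X a w j) a w))%E @ \oo --> p)}.

End Extension.

End RandomShift.

(* Main.v *)
Require Import Defs.
From HB Require Import structures.
From mathcomp Require Import all_boot all_order all_algebra.
From mathcomp Require Import all_classical all_reals all_analysis.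
From mathcomp Require Import measurable_realfun ring lra.
Import Order.TTheory GRing.Theory Num.Theory.
Import numFieldNormedType.Exports.
Set Implicit Arguments.
Unset Strict Implicit.
Unset Printing Implicit Defensive.
Local Open Scope classical_set_scope.
Local Open Scope ring_scope.

(** The sum for [psi] runs over fewer words than the sum for its
    abelianization, so [p <= p_ab]. For the converse, fix a real number [t > p];
    the words whose product is a commutator are shown not to grow faster than
    [exp (t n)].

    Reduction to loops. The least essential letter [a] belongs to almost every
    alphabet ([least_essential_letter]), and mixing produces a point starting
    with [a] over almost every environment. Hence the visit times of [a] are all
    the integers, and only loops at [a] matter. Choosing these points measurably
    ([point_selection]) gives each loop a weight that is measurable in the
    environment and multiplicative up to a distortion of integrable size.

    Superharmonicity. As [t > p], the Green function [green t g w], the sum of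
    [exp (- t |u|) weight u] over the loops [u] at [w] with product [g], is
    finite. Cutting loops after [n] letters ([green_superharmonic]) gives, up to
    distortion,
      [sum_u exp (- t n) weight u * green (psi(u)^-1 g) (theta^n w) <= green g w],
    where [u] runs over loops of length [n]. If the ratios
    [green (x^-1 g) (theta^n w) / green g w] were equal to [exp (chi x) c_n(w)]
    with [chi] a homomorphism into the reals and [log c_n] of integral zero,
    then [chi] would vanish on commutators, and the inequality would bound the
    total weight of the words with a commutator product by [exp (t n)].
    An invariant mean provides such a [chi], by averaging the logarithm of the
    ratio over [g].

    Averaging. The mean of a family of measurable functions need not be
    measurable, and the logarithms are only bounded above, by an integrable
    function of [w] (this is the Harnack inequality [defect_ge0], from mixing).
    So the bounded-above logarithm is turned into the nonnegative
    [defect n x g w]; it is truncated, integrated over [w] against a bounded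
    weight, averaged over [g], and only then is the truncation removed
    ([weighted_mean]). This operation is additive and compatible with the shift
    of environments. The defects form a cocycle in [(n, x)], so
    the averages satisfy the identity of [twisted_cocycle_commutator], which says
    that commutators have the same averaged defect as the identity. At the
    identity the logarithm is a coboundary in [w], and its truncated integral
    is controlled by [integral_coboundary_truncation]. Together these facts make
    up [commutator_defect_le].

    Conclusion. On an event [E] on which the commutator words of length [n] have
    weight at least [exp (t' n)] with [t' > t], convexity of the exponential
    ([weighted_min_ge]) bounds the defects averaged with the normalized
    weights of these words from below; comparison with the upper bound gives
    [(t' - t) n P(E) <= C + cost outside E] ([growth_bound]). If [t' < p_ab], such
    events have probability close to [1] for large [n], and the cost
    outside of [E] is then a small multiple of [n]: a contradiction ([no_gap]). *)

(** * Twisted cocycles and commutators *)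

Section TwistedCocycle.
Variables (V : zmodType) (G : groupType) (S : Type) (Q : S -> Prop).
Variables (sig : S -> S) (f : nat -> S -> G -> V) (N : G -> nat).
Hypothesis sigQ : forall a, Q a -> Q (sig a).
Hypothesis fM : forall n k a x y, Q a -> (N x <= n)%N -> (N y <= k)%N ->
  f (n + k) a (x * y)%g = f n a x + f k (iter n sig a) y.

Let c n a x := f n a x - f n a 1%g.

Let iterQ n a : Q a -> Q (iter n sig a).
Proof. by move=> Qa; elim: n => //= n; exact: sigQ. Qed.

Let c_shift n k a x : Q a -> (N x <= n)%N -> (N 1%g <= n)%N ->
  (N x <= k)%N -> (N 1%g <= k)%N -> c n a x = c k (iter n sig a) x.
Proof.
move=> Qa xn en xk ek; have := fM Qa xn ek; have := fM Qa en xk.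
rewrite mul1g mulg1 => -> E; apply/eqP; rewrite /c subr_eq addrAC eq_sym subr_eq.
by rewrite [_ + f n a 1%g]addrC E.
Qed.

Let c_indep n n' a x : Q a -> (N x <= n)%N -> (N 1%g <= n)%N ->
  (N x <= n')%N -> (N 1%g <= n')%N -> c n a x = c n' a x.
Proof.
move=> Qa xn en xn' en'.
rewrite (c_shift Qa xn en xn' en') (c_shift (iterQ n Qa) xn' en' xn en).
rewrite (c_shift Qa xn' en' xn en) (c_shift (iterQ n' Qa) xn en xn en).
by rewrite -!iterD addnC.
Qed.

Let M x := maxn (N x) (N 1%g).

Let c_mul a x y : Q a -> c (M (x * y)) a (x * y)%g = c (M x) a x + c (M y) a y.
Proof.
move=> Qa; pose n := maxn (M x) (maxn (M y) (M (x * y)%g)).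
have xn : (N x <= n)%N by rewrite !leq_max leqnn.
have en : (N 1%g <= n)%N by rewrite !leq_max leqnn orbT.
have yn : (N y <= n)%N by rewrite !leq_max leqnn !orbT.
have xyn : (N (x * y)%g <= n)%N by rewrite !leq_max leqnn !orbT.
have MM z : (N z <= M z)%N /\ (N 1%g <= M z)%N by rewrite !leq_max !leqnn orbT.
have [x1 x2] := MM x; have [y1 y2] := MM y; have [z1 z2] := MM (x * y)%g.
rewrite (c_indep (n' := (n + n)%N) Qa z1 z2) ?(leq_trans xyn) ?(leq_trans en) ?leq_addr //.
rewrite (c_indep Qa x1 x2 xn en) (c_indep Qa y1 y2 yn en).
rewrite (c_shift Qa yn en yn en) /c (fM Qa xn yn).
by have := fM Qa en en; rewrite mulg1 => ->; rewrite opprD addrACA.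
Qed.

(** For large [n] the difference [f n a x - f n a 1] depends neither on [n] nor
    on the shift of [a]: expand [f (n + k) a x] along both [x * 1] and [1 * x].
    The cocycle identity then makes it a homomorphism in [x] with values in an
    abelian group, so it vanishes on commutators. *)
Lemma twisted_cocycle_commutator n a x : Q a -> commutator_subgroup x ->
  (N x <= n)%N -> (N 1%g <= n)%N -> f n a x = f n a 1%g.
Proof.
move=> Qa Cx xn en; apply/eqP; rewrite -subr_eq0; apply/eqP; rewrite -/(c n a x).
rewrite (c_indep (n' := M x) Qa xn en) ?leq_max ?leqnn ?orbT //.
pose h x := c (M x) a x; rewrite -/(h x).
have hM y z : h (y * z)%g = h y + h z by exact: c_mul.
have h1 : h 1%g = 0 by rewrite /h /c subrr.
have hV y : h (y^-1)%g = - h y.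
  by apply/eqP; rewrite -addr_eq0 -hM mulVg h1.
apply: (Cx [set x | h x = 0]); split.
  split=> //= [y z hy hz|y hy]; first by rewrite hM hy hz addr0.
  by rewrite hV hy oppr0.
move=> y z /=; rewrite /commg /conjg !hM !hV [- h z + _]addrCA.
by rewrite [- h z + _]addrC subrr addr0 addrC subrr.
Qed.

End TwistedCocycle.

(** * Bounded measurable functions and preserved integrals *)

Section BoundedMeasurable.
Context (R : realType) (d : measure_display) (T : measurableType d).
Context (P : probability T R).

Definition bounded_meas (f : T -> R) : Prop :=
  measurable_fun [set: T] f /\ exists M, forall w, `|f w| <= M.

Lemma bounded_meas_integrable f : bounded_meas f -> P.-integrable [set: T] (EFin \o f).
Proof.
move=> [mf [M fM]]; apply: measurable_bounded_integrable => //; first by rewrite -ge0_fin_numE ?fin_num_measure.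
exists M; split; first by rewrite num_real.
by move=> x /ltW Mx y _; apply: le_trans Mx.
Qed.

Lemma bounded_meas_cst (c : R) : bounded_meas (fun=> c).
Proof. by split => //; exists `|c|. Qed.

Lemma bounded_measD f g : bounded_meas f -> bounded_meas g -> bounded_meas (fun w => f w + g w).
Proof.
move=> [mf [M fM]] [mg [M' gM]]; split; first exact: measurable_funD.
by exists (M + M') => w; apply: le_trans (ler_normD _ _) _; rewrite lerD.
Qed.

Lemma bounded_measM f g : bounded_meas f -> bounded_meas g -> bounded_meas (fun w => f w * g w).
Proof.
move=> [mf [M fM]] [mg [M' gM]]; split; first exact: measurable_funM.
by exists (M * M') => w; rewrite normrM ler_pM.
Qed.

Lemma bounded_meas_sum (I : Type) (s : seq I) (f : I -> T -> R) :
  (forall i, bounded_meas (f i)) -> bounded_meas (fun w => \sum_(i <- s) f i w).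
Proof.
move=> bf; elim: s => [|i s IH].
  by under eq_fun do rewrite big_nil; exact: bounded_meas_cst.
by under eq_fun do rewrite big_cons; apply: bounded_measD.
Qed.

Lemma bounded_meas_indic A : measurable A -> bounded_meas (\1_A : T -> R).
Proof.
move=> mA; split; first exact: measurable_indic.
by exists 1 => w; rewrite ger0_norm ?indic_ge0// indicE lern1 leq_b1.
Qed.

Lemma Rintegral_cstT (c : R) : \int[P]_w c = c.
Proof.
rewrite Rintegral_cst// -[RHS]mulr1; congr (_ * _).
exact: (congr1 fine (probability_setT P)).
Qed.

Lemma le_Rint f g : P.-integrable [set: T] (EFin \o f) ->
  P.-integrable [set: T] (EFin \o g) ->
  (forall w, f w <= g w) -> \int[P]_w f w <= \int[P]_w g w.
Proof. by move=> intf intg fg; apply: le_Rintegral. Qed.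

Lemma Rint_normr_le f c : bounded_meas f -> (forall w, `|f w| <= c) ->
  `|\int[P]_w f w| <= c.
Proof.
move=> bf fc; have [lo hi] : (forall w, - c <= f w) /\ (forall w, f w <= c).
  by split=> w; have := fc w; rewrite ler_norml => /andP[].
rewrite ler_norml; apply/andP; split.
  rewrite -(Rintegral_cstT (- c)); apply: le_Rint => //; apply: bounded_meas_integrable => //.
  exact: bounded_meas_cst.
rewrite -[leRHS](Rintegral_cstT c); apply: le_Rint => //; apply: bounded_meas_integrable => //.
exact: bounded_meas_cst.
Qed.

Definition preserving (h : T -> T) : Prop :=
  measurable_fun [set: T] h /\ forall A, measurable A -> P (h @^-1` A) = P A.

Lemma preserving_iter h n : preserving h -> preserving (iter n h).
Proof.
move=> [mh Ph]; elim: n => [|n [mi Pi]]; first by split => //; exact: measurable_id.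
split; first by apply: (measurableT_comp mh mi).
move=> A mA; rewrite (_ : _ @^-1` A = iter n h @^-1` (h @^-1` A))// Pi ?Ph//.
by rewrite -[X in measurable X]setTI; exact: mh.
Qed.

Lemma preserving_ge0_integral h f : preserving h ->
  measurable_fun [set: T] f -> (forall w, 0 <= f w)%E ->
  (\int[P]_w f (h w) = \int[P]_w f w)%E.
Proof.
move=> [mh Ph] mf f0.
rewrite -[LHS](ge0_integral_pushforward mh P (D := setT))//.
by apply: eq_measure_integral => A mA _; exact: Ph.
Qed.

Lemma preserving_integrable h f : preserving h ->
  P.-integrable [set: T] f -> P.-integrable [set: T] (f \o h).
Proof.
move=> Ph /integrableP[mf intf]; apply/integrableP; split.
  by apply: measurableT_comp => //; case: Ph.
rewrite (preserving_ge0_integral (f := fun w => `|f w|%E) Ph)//.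
exact: measurableT_comp.
Qed.

Lemma preserving_Rint h f : preserving h ->
  P.-integrable [set: T] (EFin \o f) -> \int[P]_w f (h w) = \int[P]_w f w.
Proof.
move=> Ph intf; rewrite /Rintegral; congr fine.
have [mh Ph'] := Ph.
rewrite -[LHS](integral_pushforward mh (f := EFin \o f) (D := setT))//.
- by apply: eq_measure_integral => A mA _; exact: Ph'.
- by case/integrableP: intf.
- exact: preserving_integrable.
Qed.

Lemma preserving_ae h (Q : T -> Prop) : preserving h ->
  {ae P, forall w, Q w} -> {ae P, forall w, Q (h w)}.
Proof.
move=> [mh Ph] [A [mA A0 sA]]; exists (h @^-1` A); split.
- by rewrite -[X in measurable X]setTI; exact: mh.
- by rewrite Ph.
- by move=> w; exact: sA.
Qed.

Lemma ae_forall_nat (Q : nat -> T -> Prop) :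
  (forall n, {ae P, forall w, Q n w}) -> {ae P, forall w, forall n, Q n w}.
Proof. by move=> h; apply: ae_foralln. Qed.

End BoundedMeasurable.

(** * Invariant sets of full measure *)

Section Invariant.
Context (R : realType) (d : measure_display) (T : measurableType d).
Context (P : probability T R) (h hi : T -> T).
Hypotheses (Ph : preserving P h) (Phi : preserving P hi).
Hypotheses (hK : cancel h hi) (hiK : cancel hi h).

Lemma ae_invariant_set (Q : T -> Prop) : {ae P, forall w, Q w} ->
  exists A : set T, [/\ measurable A, P (~` A) = 0%E,
    forall w, A (h w) <-> A w & A `<=` Q].
Proof.
move=> [N [mN N0 sN]].
pose A := \bigcap_n (iter n h @^-1` (~` N) `&` iter n hi @^-1` (~` N)).
have mpre n k : preserving P k -> measurable (iter n k @^-1` (~` N)).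
  move=> Pk; have [mk _] := preserving_iter n Pk.
  by rewrite -[X in measurable X]setTI; apply: mk => //; exact: measurableC.
have mA : measurable A by apply: bigcapT_measurable => n; apply: measurableI; exact: mpre.
exists A; split => //.
- have aeN : {ae P, forall w, ~ N w}.
    by exists N; split => // w /= /contrapT.
  apply/negligibleP; first exact: measurableC.
  have : {ae P, forall w, forall n, ~ N (iter n h w) /\ ~ N (iter n hi w)}.
    apply: ae_forall_nat => n; apply: filterS2
      (preserving_ae (preserving_iter n Ph) aeN)
      (preserving_ae (preserving_iter n Phi) aeN) => w /=; by split.
  by apply: negligibleS => w Aw /= W; apply: Aw => n _; exact: W.
- move=> w; split=> Aw [|n] _ /=.
  + have [_] := Aw 1%N I; rewrite /= hK //.
  + split; first by have [+ _] := Aw n I; rewrite /= -iterSr.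
    by have [_] := Aw n.+2 I; rewrite /= -!iterS !iterSr hK.
  + by have [+ _] := Aw 1%N I.
  + split; first by have [+ _] := Aw n.+2 I; rewrite /= -!iterS iterSr.
    by have [_] := Aw n I; rewrite /= -iterS iterSr hK.
- move=> w Aw; apply: contrapT => nQ; have [+ _] := Aw 0%N I; apply.
  exact: sN.
Qed.

End Invariant.

(** * The mean of a family of integrals *)

Section MeanFunctional.
Context (R : realType) (d : measure_display) (T : measurableType d).
Context (P : probability T R) (G : groupType) (m : (G -> R) -> R).
Hypothesis m_mean : invariant_mean m.

Let m_lin (c : R) f g : bounded_real f -> bounded_real g ->
  m (fun x => c * f x + g x) = c * m f + m g.
Proof. by case: m_mean => + _ _ _; apply. Qed.

Let bounded_cst (c : R) : bounded_real (fun _ : G => c).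
Proof. by exists `|c|. Qed.

Let m_cst (c : R) : m (fun=> c) = c.
Proof.
have m0 : m (fun=> 0) = 0.
  have := m_lin 1 (bounded_cst 0) (bounded_cst 0).
  under [X in m X]eq_fun do rewrite mulr0 addr0.
  by move=> /eqP; rewrite mul1r -subr_eq subrr eq_sym => /eqP.
have := m_lin c (bounded_cst 1) (bounded_cst 0).
under [X in m X]eq_fun do rewrite mulr1 addr0.
by case: m_mean => _ _ -> _; rewrite m0 mulr1 addr0.
Qed.

Let m_le f g : bounded_real f -> bounded_real g -> (forall x, f x <= g x) ->
  m f <= m g.
Proof.
move=> bf bg fg; have := m_lin (-1) bf bg.
set h := fun x => _; have bh : bounded_real h.
  have [[M fM] [M' gM]] := (bf, bg); exists (M + M') => x.
  by rewrite /h mulN1r (le_trans (ler_normD _ _))// normrN lerD.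
have : 0 <= m h.
  case: m_mean => _ + _ _; apply => // x.
  by rewrite /h mulN1r addrC subr_ge0.
by move=> + E; rewrite E mulN1r addrC subr_ge0.
Qed.

Definition bounded_family (F : G -> T -> R) : Prop :=
  (forall g, measurable_fun [set: T] (F g)) /\
  exists M, forall g w, `|F g w| <= M.

Lemma bounded_family_bounded_meas F g : bounded_family F -> bounded_meas (F g).
Proof. by move=> [mF [M FM]]; split => //; exists M. Qed.

Definition mean_integral (F : G -> T -> R) : R :=
  m (fun g => \int[P]_w F g w).

Let bounded_int F : bounded_family F -> bounded_real (fun g => \int[P]_w F g w).
Proof.
move=> bF; have [mF [M FM]] := bF; exists M => g.
by apply: Rint_normr_le => //; exact: bounded_family_bounded_meas.
Qed.

Lemma mean_integralD F F' : bounded_family F -> bounded_family F' ->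
  mean_integral (fun g w => F g w + F' g w) = mean_integral F + mean_integral F'.
Proof.
move=> bF bF'; rewrite -[X in X + _]mul1r -m_lin; [|exact: bounded_int..].
congr m; apply/funext => g; rewrite mul1r RintegralD//;
  exact/bounded_meas_integrable/bounded_family_bounded_meas.
Qed.

Lemma le_mean_integral F F' : bounded_family F -> bounded_family F' ->
  (forall g w, F g w <= F' g w) -> mean_integral F <= mean_integral F'.
Proof.
move=> bF bF' FF'; apply: m_le; [exact: bounded_int..|move=> g].
by apply: le_Rint => // ; exact/bounded_meas_integrable/bounded_family_bounded_meas.
Qed.

Lemma mean_integral_le F c : bounded_family F ->
  (forall g, \int[P]_w F g w <= c) -> mean_integral F <= c.
Proof. by move=> bF Fc; rewrite -[leRHS]m_cst; apply: m_le => //; exact: bounded_int. Qed.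

Lemma mean_integral_ge F c : bounded_family F ->
  (forall g, c <= \int[P]_w F g w) -> c <= mean_integral F.
Proof. by move=> bF Fc; rewrite -[leLHS]m_cst; apply: m_le => //; exact: bounded_int. Qed.

Lemma mean_integral_shift h x F : preserving P h -> bounded_family F ->
  mean_integral (fun g w => F (x * g)%g (h w)) = mean_integral F.
Proof.
move=> Ph bF; rewrite /mean_integral.
transitivity (m (fun g => \int[P]_w F (x * g)%g w)); last first.
  by case: m_mean => _ _ _ /(_ x _ (bounded_int bF)).
congr m; apply/funext => g; apply: (preserving_Rint (f := F (x * g)%g)) => //.
exact/bounded_meas_integrable/bounded_family_bounded_meas.
Qed.

(** ** Extension to unbounded families *)

Definition weight (a : T -> R) : Prop := bounded_meas a /\ forall w, 0 <= a w.

(** Nonnegativity is required only where the weight charges: for the product of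
    a short word, the Harnack inequality is available only over the environments
    where that word is a loop. *)
Definition nneg_family (a : T -> R) (y : G -> T -> R) : Prop :=
  (forall g, measurable_fun [set: T] (y g)) /\
  forall g w, a w != 0 -> 0 <= y g w.

Definition truncation (a : T -> R) (y : G -> T -> R) (K : R) : G -> T -> R :=
  fun g w => a w * Num.min (y g w) K.

Lemma truncation_bounded a y K : weight a -> nneg_family a y -> 0 <= K ->
  bounded_family (truncation a y K).
Proof.
move=> [[ma [M aM]] a0] [my y0] K0; split.
  by move=> g; apply: measurable_funM => //; exact: measurable_minr.
exists (M * K) => g w; rewrite /truncation normrM.
have [->|aw] := eqVneq (a w) 0.
  by rewrite normr0 mul0r mulr_ge0// (le_trans _ (aM w)).
apply: ler_pM => //.
by rewrite ger0_norm ?ge_min ?lexx ?orbT// le_min K0 y0.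
Qed.

(** The supremum over the truncation levels plays the role of an integral of
    the unbounded family [y]; unlike a mean of integrals, it ignores mass that
    escapes to infinity. *)
Definition weighted_mean (a : T -> R) (y : G -> T -> R) : R :=
  sup (range (fun K : nat => mean_integral (truncation a y K%:R))).

Definition mean_bounded (a : T -> R) (y : G -> T -> R) : Prop :=
  exists c, forall K : nat, mean_integral (truncation a y K%:R) <= c.

Let has_ub a y : mean_bounded a y ->
  has_ubound (range (fun K : nat => mean_integral (truncation a y K%:R))).
Proof. by move=> [c hc]; exists c => _ [K _ <-]. Qed.

Lemma weighted_mean_ge a y (K : nat) : mean_bounded a y ->
  mean_integral (truncation a y K%:R) <= weighted_mean a y.
Proof. by move=> /has_ub h; apply: ub_le_sup => //; exists K. Qed.

Lemma weighted_mean_le a y c :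
  (forall K : nat, mean_integral (truncation a y K%:R) <= c) ->
  weighted_mean a y <= c.
Proof.
move=> h; apply: ge_sup; first by exists (mean_integral (truncation a y 0%:R)), 0%N.
by move=> _ [K _ <-].
Qed.

Lemma truncation_le a y y' K K' : weight a -> nneg_family a y ->
  nneg_family a y' -> 0 <= K -> K <= K' ->
  (forall g w, a w != 0 -> y g w <= y' g w) ->
  mean_integral (truncation a y K) <= mean_integral (truncation a y' K').
Proof.
move=> wa ny ny' K0 KK' yy'; apply: le_mean_integral.
- exact: truncation_bounded.
- by apply: truncation_bounded => //; exact: le_trans KK'.
move=> g w; rewrite /truncation; have [->|aw] := eqVneq (a w) 0; first by rewrite !mul0r.
have [_ a0] := wa; apply: ler_wpM2l => //.
by rewrite le_min !ge_min yy'// KK' orbT.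
Qed.

Lemma le_mean_bounded a y y' : weight a -> nneg_family a y ->
  nneg_family a y' -> (forall g w, a w != 0 -> y g w <= y' g w) ->
  mean_bounded a y' -> mean_bounded a y.
Proof.
move=> wa ny ny' yy' [c hc]; exists c => K; apply: le_trans (hc K).
exact: truncation_le.
Qed.

(** Truncation is subadditive, and superadditive up to doubling the level; the
    level disappears in the supremum. *)
Lemma weighted_meanD a y y' : weight a -> nneg_family a y ->
  nneg_family a y' -> mean_bounded a (fun g w => y g w + y' g w) ->
  weighted_mean a (fun g w => y g w + y' g w) =
  weighted_mean a y + weighted_mean a y'.
Proof.
move=> wa ny ny' bd; set ys := fun g w => _; rewrite -/ys in bd *.
have [my y0] := ny; have [my' y0'] := ny'; have [_ a0] := wa.
have nys : nneg_family a ys.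
  split=> [g|g w aw]; first exact: measurable_funD.
  by rewrite addr_ge0 ?y0 ?y0'.
have b1 : mean_bounded a y.
  by apply: (le_mean_bounded wa ny nys _ bd) => g w aw; rewrite lerDl y0'.
have b2 : mean_bounded a y'.
  by apply: (le_mean_bounded wa ny' nys _ bd) => g w aw; rewrite lerDr y0.
apply/eqP; rewrite eq_le; apply/andP; split.
  apply: weighted_mean_le => K.
  apply: le_trans (lerD (weighted_mean_ge K b1) (weighted_mean_ge K b2)).
  rewrite -mean_integralD; [|exact: truncation_bounded..].
  apply: le_mean_integral; first exact: truncation_bounded.
    have := truncation_bounded wa ny (ler0n R K).
    have := truncation_bounded wa ny' (ler0n R K).
    move=> [m2 [M2 B2]] [m1 [M1 B1]]; split.
      by move=> g; exact: measurable_funD.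
    by exists (M1 + M2) => g w; rewrite (le_trans (ler_normD _ _))// lerD.
  move=> g w; rewrite /truncation; have [->|aw] := eqVneq (a w) 0.
    by rewrite !mul0r addr0.
  rewrite -mulrDr ler_wpM2l //; have := y0 g w aw; have := y0' g w aw.
  rewrite /ys !minEle; have := ler0n R K.
  by case: ifPn; case: ifPn; case: ifPn; rewrite -?ltNge; lra.
have step (K K' : nat) : mean_integral (truncation a y K%:R) +
    mean_integral (truncation a y' K'%:R) <= weighted_mean a ys.
  pose k := maxn K K'; apply: le_trans (weighted_mean_ge (k + k)%N bd).
  have le1 : mean_integral (truncation a y K%:R) <= mean_integral (truncation a y k%:R).
    by apply: truncation_le => //; rewrite ler_nat leq_maxl.
  have le2 : mean_integral (truncation a y' K'%:R) <= mean_integral (truncation a y' k%:R).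
    by apply: truncation_le => //; rewrite ler_nat leq_maxr.
  apply: le_trans (lerD le1 le2) _.
  rewrite -mean_integralD; [|exact: truncation_bounded..].
  apply: le_mean_integral; last 2 first.
  - exact: truncation_bounded.
  - move=> g w; rewrite /truncation; have [->|aw] := eqVneq (a w) 0.
      by rewrite !mul0r addr0.
    rewrite -mulrDr ler_wpM2l //; have := y0 g w aw; have := y0' g w aw.
    rewrite /ys natrD !minEle.
    by case: ifPn; case: ifPn; case: ifPn; rewrite -?ltNge; lra.
  have := truncation_bounded wa ny (ler0n R k).
  have := truncation_bounded wa ny' (ler0n R k).
  move=> [m2 [M2 B2]] [m1 [M1 B1]]; split.
    by move=> g; exact: measurable_funD.
  by exists (M1 + M2) => g w; rewrite (le_trans (ler_normD _ _))// lerD.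
rewrite -lerBrDr; apply: weighted_mean_le => K; rewrite lerBrDr addrC -lerBrDr.
by apply: weighted_mean_le => K'; rewrite lerBrDr addrC.
Qed.

Lemma truncation_shift h hi x a y K : preserving P h -> cancel h hi ->
  weight a -> preserving P hi -> nneg_family (a \o hi) y -> 0 <= K ->
  mean_integral (truncation a (fun g w => y (x * g)%g (h w)) K) =
  mean_integral (truncation (a \o hi) y K).
Proof.
move=> Ph hK wa Phi ny K0.
have wahi : weight (a \o hi).
  have [[ma [M aM]] a0] := wa; split; last by move=> w; exact: a0.
  split; last by exists M => w; exact: aM.
  by apply: measurableT_comp => //; case: Phi.
rewrite -(mean_integral_shift x Ph (truncation_bounded wahi ny K0)).
by congr mean_integral; apply/funext => g; apply/funext => w; rewrite /truncation /= hK.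
Qed.

Lemma weighted_mean_shift h hi x a y : preserving P h -> cancel h hi ->
  weight a -> preserving P hi -> nneg_family (a \o hi) y ->
  weighted_mean a (fun g w => y (x * g)%g (h w)) = weighted_mean (a \o hi) y.
Proof.
move=> Ph hK wa Phi ny; rewrite /weighted_mean; apply: (congr1 (fun F => sup (range F))).
by apply/funext => K; exact: (truncation_shift x Ph hK wa Phi ny (ler0n _ K)).
Qed.

End MeanFunctional.

(** * Integrals of coboundaries bounded above *)

Section Coboundary.
Context (R : realType) (d : measure_display) (T : measurableType d).
Context (P : probability T R) (h : T -> T) (q b : T -> R).
Hypotheses (Ph : preserving P h) (mq : measurable_fun [set: T] q).
Hypotheses (ib : P.-integrable [set: T] (EFin \o b)) (b0 : forall w, 0 <= b w).
Hypothesis qb : forall w, q (h w) - q w <= b w.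

(** Clamping [q] to [-M, M] makes the coboundary integrable with zero integral
    and does not destroy the bound by [b], because clamping is nondecreasing and
    1-Lipschitz; then let [M] go to infinity. *)
Lemma integral_coboundary_truncation (K : R) : 0 <= K ->
  \int[P]_w Num.min (b w - q (h w) + q w) K <= \int[P]_w b w.
Proof.
move=> K0.
pose cl (M : nat) (x : R) := Num.max (- M%:R) (Num.min x M%:R).
have clM M x : `|cl M x| <= M%:R.
  rewrite /cl ler_norml le_max lexx /= ge_max (le_trans (_ : _ <= 0))//= ?oppr_le0//.
  by rewrite ge_min lexx orbT.
have mcl M : measurable_fun [set: T] (cl M \o q).
  by apply: measurable_maxr => //; exact: measurable_minr.
have bcl M : bounded_meas (cl M \o q) by split => //; exists M%:R => w; exact: clM.
have [mh _] := Ph.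
have mb : measurable_fun [set: T] b by move/integrableP : ib => [/measurable_EFinP].
have bclh M : bounded_meas (cl M \o q \o h).
  by split; [exact: measurableT_comp|exists M%:R => w; exact: clM].
pose y M w := b w - cl M (q (h w)) + cl M (q w).
have my M : measurable_fun [set: T] (y M).
  apply: (measurable_funD (f := b \- (cl M \o q \o h)) (g := cl M \o q)) => //.
  by apply: measurable_funB => //; case: (bclh M).
have y0 M w : 0 <= y M w.
  have := qb w; have := b0 w; rewrite /y /cl !maxEle !minEle.
  have := ler0n R M; do 4 (case: ifPn; rewrite -?ltNge); lra.
have iyM M : P.-integrable [set: T] (EFin \o y M).
  rewrite (_ : EFin \o y M = ((EFin \o b) \- (EFin \o (cl M \o q \o h))) \+
    (EFin \o (cl M \o q)))%E //.
  apply: integrableD => //; last exact: bounded_meas_integrable.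
  by apply: integrableB => //; exact: bounded_meas_integrable.
have Ey M : \int[P]_w y M w = \int[P]_w b w.
  rewrite /y (RintegralD (f1 := fun w => b w - cl M (q (h w)))) //=; last 2 first.
  - rewrite (_ : EFin \o _ = (EFin \o b) \- (EFin \o (cl M \o q \o h)))%E//.
    by apply: integrableB => //; exact: bounded_meas_integrable.
  - exact: (bounded_meas_integrable P (bcl M)).
  rewrite (RintegralB (f2 := cl M \o q \o h)) //; last exact: bounded_meas_integrable.
  rewrite (preserving_Rint (f := cl M \o q) Ph); last exact: bounded_meas_integrable.
  by rewrite subrK.
have bmin (f : T -> R) : measurable_fun [set: T] f -> (forall w, 0 <= f w) ->
    bounded_meas (fun w => Num.min (f w) K).
  move=> mf f0; split; first exact: measurable_minr.
  by exists K => w; rewrite ger0_norm ?ge_min ?lexx ?orbT// le_min K0 f0.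
have yl w : \forall M \near \oo, y M w = b w - q (h w) + q w.
  near=> M.
  have Mq z : `|z| <= M%:R -> cl M z = z.
    by rewrite ler_norml /cl => /andP[zl zr]; rewrite min_l// max_r.
  by rewrite /y !Mq//; near: M; exact: nbhs_infty_ger.
have y0' w : 0 <= b w - q (h w) + q w by have := qb w; lra.
have bz : bounded_meas (fun w => Num.min (b w - q (h w) + q w) K).
  apply: bmin => //; apply: (measurable_funD (f := b \- (q \o h)) (g := q)) => //.
  by apply: measurable_funB => //; exact: measurableT_comp.
have leM M : \int[P]_w Num.min (y M w) K <= \int[P]_w b w.
  rewrite -(Ey M); apply: le_Rint => //; first exact/bounded_meas_integrable/bmin.
  by move=> w; rewrite ge_min lexx.
have RE f : bounded_meas f -> (\int[P]_w (f w)%:E = (\int[P]_w f w)%:E)%E.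
  by move=> bf; rewrite /Rintegral fineK//; apply: integrable_fin_num => //; exact: (bounded_meas_integrable P bf).
have mM M : bounded_meas (fun w => Num.min (y M w) K) by exact: bmin.
have cv : (fun M => \int[P]_w (Num.min (y M w) K)%:E)%E @ \oo -->
    (\int[P]_w (Num.min (b w - q (h w) + q w) K)%:E)%E.
  have [|||||_ _ //] := @dominated_convergence _ _ _ P setT measurableT
    (fun M w => (Num.min (y M w) K)%:E)
    (fun w => (Num.min (b w - q (h w) + q w) K)%:E) (fun=> K%:E).
  - by move=> M; apply/measurable_EFinP; case: (mM M).
  - by apply/measurable_EFinP; case: bz.
  - apply: aeW => w _; apply: cvg_near_cst; apply: filterS (yl w) => M /= yE.
    by rewrite yE.
  - by apply: (@bounded_meas_integrable _ _ _ P (fun=> K)); exact: bounded_meas_cst.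
  - apply: aeW => w M _; rewrite lee_fin ger0_norm ?ge_min ?lexx ?orbT//.
    by rewrite le_min K0 y0.
rewrite -lee_fin -RE // -(cvg_lim _ cv)//; apply: lime_le; first by apply/cvg_ex; eexists; exact: cv.
by near=> M; rewrite RE ?lee_fin.
Unshelve. all: by end_near. Qed.

End Coboundary.

(** * Commutators do not change the weighted means *)

(** By monotonicity the levels of finitely many suprema can be taken equal. *)
Lemma sum_sup_le (R : realType) (I : Type) (s : seq I) (u : I -> nat -> R) (C : R) :
  (forall i K K', (K <= K')%N -> u i K <= u i K') ->
  (forall K, \sum_(i <- s) u i K <= C) ->
  \sum_(i <- s) sup (range (u i)) <= C.
Proof.
move=> umono; elim: s C => [|i s IH] C uC.
  by have := uC 0%N; rewrite !big_nil.
rewrite big_cons -lerBrDr; apply: ge_sup; first by exists (u i 0%N), 0%N.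
move=> _ [K _ <-]; rewrite lerBrDr addrC -lerBrDr; apply: IH => K'.
rewrite lerBrDr; apply: le_trans (uC (maxn K K')); rewrite big_cons addrC lerD //.
  by rewrite umono// leq_maxl.
by apply: ler_sum => j _; rewrite umono// leq_maxr.
Qed.

Section CommutatorDefect.
Context (R : realType) (d : measure_display) (T : measurableType d).
Context (P : probability T R) (G : groupType) (m : (G -> R) -> R).
Hypothesis m_mean : invariant_mean m.
Context (h hi : T -> T).
Hypotheses (Ph : preserving P h) (Phi : preserving P hi).
Hypotheses (hK : cancel h hi).
Context (q : G -> T -> R) (beta : T -> R) (N : G -> nat).
Hypothesis mq : forall g, measurable_fun [set: T] (q g).
Hypothesis ibeta : P.-integrable [set: T] (EFin \o beta).
Hypothesis beta0 : forall w, 0 <= beta w.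

Definition orbit_sum (n : nat) (w : T) : R := \sum_(i < n) beta (iter i h w).

(** When [q] is the logarithm of the Green function, nonnegativity of the defect
    is the Harnack inequality. *)
Definition defect (n : nat) (x g : G) (w : T) : R :=
  orbit_sum n w - q (x^-1 * g)%g (iter n h w) + q g w.

Hypothesis defect_ge0 : forall n x g w, (N x <= n)%N -> 0 <= defect n x g w.

Let b0 n w : 0 <= orbit_sum n w. Proof. by apply: sumr_ge0. Qed.

Lemma orbit_sum_integrable n : P.-integrable [set: T] (EFin \o orbit_sum n).
Proof.
rewrite (_ : EFin \o _ = (fun w => \sum_(i < n) (beta (iter i h w))%:E)%E).
  apply: integrable_sum => // i _.
  exact: (preserving_integrable (preserving_iter i Ph) ibeta).
by apply/funext => w; rewrite /= -sumEFin.
Qed.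

Let defectD n k x z g w :
  defect (n + k) (x * z)%g g w = defect n x g w + defect k z (x^-1 * g)%g (iter n h w).
Proof.
rewrite /defect /orbit_sum big_split_ord /=.
under [X in _ + X - _ + _]eq_bigr do rewrite addnC iterD.
by rewrite invgM mulgA [(n + k)%N]addnC iterD; ring.
Qed.

Let mdefect n x g : measurable_fun [set: T] (defect n x g).
Proof.
have /integrableP[/measurable_EFinP mb _] := orbit_sum_integrable n.
have [mh _] := preserving_iter n Ph.
apply: (measurable_funD (f := orbit_sum n \- (q (x^-1 * g)%g \o iter n h)) (g := q g)) => //.
by apply: measurable_funB => //; exact: measurableT_comp.
Qed.

Lemma measurable_defect n x g : measurable_fun [set: T] (defect n x g).
Proof. exact: mdefect. Qed.

Let nneg n x a : (N x <= n)%N -> nneg_family a (defect n x).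
Proof. by move=> xn; split => // g w _; exact: defect_ge0. Qed.

Let defect1_bounded n g (K : R) : (N 1%g <= n)%N -> 0 <= K ->
  \int[P]_w Num.min (defect n 1%g g w) K <= \int[P]_w orbit_sum n w.
Proof.
move=> n1 K0; rewrite /defect; under eq_Rintegral do rewrite invg1 mul1g.
apply: (integral_coboundary_truncation (h := iter n h) (q := q g)) => //.
- exact: preserving_iter.
- exact: orbit_sum_integrable.
move=> w; have := defect_ge0 g w n1; rewrite /defect invg1 mul1g.
by rewrite addrAC subr_ge0 lerBlDr.
Qed.

Let min_bounded_meas n g (K : R) : (N 1%g <= n)%N -> 0 <= K ->
  bounded_meas (fun w => Num.min (defect n 1%g g w) K).
Proof.
move=> n1 K0; split; first exact: measurable_minr.
exists K => w; rewrite ger0_norm ?ge_min ?lexx ?orbT// le_min K0 andbT.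
exact: defect_ge0.
Qed.

Let bounded1 n a : weight a -> (N 1%g <= n)%N -> mean_bounded P m a (defect n 1%g).
Proof.
move=> wa n1; have [[ma [M aM]] a0] := wa.
exists (M * \int[P]_w orbit_sum n w) => K.
have bt := truncation_bounded wa (nneg a n1) (ler0n R K).
apply: (mean_integral_le m_mean bt) => g.
have bm := min_bounded_meas g n1 (ler0n R K).
have Mb : bounded_meas (fun w => M * Num.min (defect n 1%g g w) K%:R).
  by apply: bounded_measM => //; exact: bounded_meas_cst.
have aM' w : a w <= M by apply: le_trans (aM w); exact: ler_norm.
apply: (@le_trans _ _ (\int[P]_w (M * Num.min (defect n 1%g g w) K%:R))).
  apply: le_Rint; [exact/bounded_meas_integrable/bounded_family_bounded_meas|exact: (bounded_meas_integrable P Mb)|].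
  by move=> w; apply: ler_wpM2r => //; rewrite le_min ler0n andbT defect_ge0.
rewrite RintegralZl//; last exact: (bounded_meas_integrable P bm).
apply: ler_wpM2l; last exact: defect1_bounded.
by apply: le_trans (aM' point); exact: a0.
Qed.

Let boundedx n x a : weight a -> nneg_family a (defect n x) ->
  mean_bounded P m a (defect n x).
Proof.
move=> wa nx; pose k := maxn (N x^-1%g) (N 1%g).
have n1 : (N 1%g <= n + k)%N by rewrite (leq_trans (leq_maxr (N x^-1%g) _))// leq_addl.
apply: (le_mean_bounded m_mean wa nx (nneg a n1) _ (bounded1 wa n1)) => g w _.
by rewrite -[in leRHS](mulgV x) defectD lerDl defect_ge0// leq_maxl.
Qed.

Let sig (a : T -> R) := a \o hi.

Let iter_sig n a : iter n sig a = a \o iter n hi.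
Proof. by elim: n => // n IH; rewrite iterS IH; apply/funext => w; rewrite /sig /comp iterSr. Qed.

Let sig_weight a : weight a -> weight (sig a).
Proof.
move=> [[ma [M aM]] a0]; split; last by move=> w; exact: a0.
split; last by exists M => w; exact: aM.
by apply: measurableT_comp => //; case: Phi.
Qed.

Let iterK n : cancel (iter n h) (iter n hi).
Proof. by elim: n => // n IH w; rewrite iterSr /= hK IH. Qed.

Let F n a x := weighted_mean P m a (defect n x).

(** This version of the cocycle identity covers words too short for mixing to
    apply: [n] need not be large for [x], as long as the weight only charges
    environments where the defect at [x] is nonnegative. *)
Let F_local n k a x z : weight a -> nneg_family a (defect n x) -> (N z <= k)%N ->
  F (n + k)%N a (x * z)%g = F n a x + F k (iter n sig a) z.
Proof.
move=> wa nx zk; rewrite /F iter_sig.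
have Phn := preserving_iter n Ph.
rewrite -(weighted_mean_shift m_mean x^-1%g Phn (iterK n) wa (preserving_iter n Phi));
  last exact: nneg.
have sE : defect (n + k) (x * z)%g =
    (fun g w => defect n x g w + defect k z (x^-1 * g)%g (iter n h w)).
  by apply/funext => g; apply/funext => w; exact: defectD.
rewrite sE weighted_meanD//.
- split=> [g|g w _]; last exact: defect_ge0.
  by apply: measurableT_comp => //; case: Phn.
- rewrite -sE; apply: boundedx => //; split=> // g w aw; rewrite defectD.
  by apply: addr_ge0; [case: nx => _ nx0; exact: nx0 | exact: defect_ge0].
Qed.

Let F_commutator n a x : weight a -> nneg_family a (defect n x) ->
  (N 1%g <= n)%N -> commutator_subgroup x -> F n a x = F n a 1%g.
Proof.
move=> wa nx n1 Cx; pose k := maxn (N x) (N 1%g).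
have k1 : (N 1%g <= k)%N by exact: leq_maxr.
apply: (addIr (F k (iter n sig a) 1%g)).
rewrite -!F_local ?mulg1//; last exact: nneg.
apply: (twisted_cocycle_commutator (Q := @weight R d T) (N := N) sig_weight) => //.
- by move=> n' k' a' x' z' wa' xn zk; apply: F_local => //; exact: nneg.
- by rewrite (leq_trans (leq_maxl _ (N 1%g)))// leq_addl.
- by rewrite (leq_trans k1)// leq_addl.
Qed.

Lemma mean_integral_sum (I : Type) (s : seq I) (H : I -> G -> T -> R) :
  (forall i, bounded_family (H i)) ->
  bounded_family (fun g w => \sum_(i <- s) H i g w) /\
  mean_integral P m (fun g w => \sum_(i <- s) H i g w) =
    \sum_(i <- s) mean_integral P m (H i).
Proof.
move=> bH; elim: s => [|i s [bs Es]].
  have -> : (fun (g : G) (w : T) => \sum_(i <- [::]) H i g w) = (fun _ _ => 0).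
    by apply/funext => g; apply/funext => w; rewrite big_nil.
  have b00 : bounded_family (fun (_ : G) (_ : T) => 0 : R).
    by split => //; exists 0 => _ _; rewrite normr0.
  split => //; rewrite big_nil; apply/eqP; rewrite eq_le.
  by rewrite mean_integral_le// ?mean_integral_ge// => g; rewrite Rintegral_cstT.
have -> : (fun g w => \sum_(j <- i :: s) H j g w) =
    (fun g w => H i g w + \sum_(j <- s) H j g w).
  by apply/funext => g; apply/funext => w; rewrite big_cons.
split; last by rewrite big_cons mean_integralD// Es.
have [mi [M iM]] := bH i; have [ms [M' sM]] := bs; split.
  by move=> g; exact: measurable_funD.
by exists (M + M') => g w; rewrite (le_trans (ler_normD _ _))// lerD.
Qed.

(** Each weighted mean of the defects at [x i] is that of the defects at the
    identity, because [x i] is a product of commutators; the weights add up to at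
    most one, and the defect at the identity is the sum of [orbit_sum n] and of a
    coboundary, whose integral contributes nothing. *)
Lemma commutator_defect_le n (I : Type) (s : seq I) (a : I -> T -> R)
    (x : I -> G) (K : nat) (c : R) :
  (N 1%g <= n)%N -> (forall i, weight (a i)) ->
  (forall i, commutator_subgroup (x i)) ->
  (forall w, \sum_(i <- s) a i w <= 1) ->
  (forall i g w, a i w != 0 -> 0 <= defect n (x i) g w) ->
  (forall g, c <= \int[P]_w \sum_(i <- s) a i w * Num.min (defect n (x i) g w) K%:R) ->
  c <= \int[P]_w orbit_sum n w.
Proof.
move=> n1 wa Cx a1 posx cle.
have nx i : nneg_family (a i) (defect n (x i)) by split=> // g w; exact: posx.
have bt i := truncation_bounded (wa i) (nx i) (ler0n R K).
have [bS ES] := mean_integral_sum s bt.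
apply: le_trans (mean_integral_ge m_mean bS cle) _; rewrite ES.
apply: (@le_trans _ _ (\sum_(i <- s) F n (a i) 1%g)).
  apply: ler_sum => i _; rewrite -(F_commutator (wa i) (nx i) n1 (Cx i)).
  by apply: weighted_mean_ge; exact: boundedx.
apply: sum_sup_le => [i K1 K2 K12|K'].
  apply: truncation_le => //; first exact: nneg.
  - exact: nneg.
  - by rewrite ler_nat.
have bt1 i := truncation_bounded (wa i) (nneg (a i) n1) (ler0n R K').
have [bS1 ES1] := mean_integral_sum s bt1.
rewrite -ES1; apply: (mean_integral_le m_mean bS1) => g.
apply: le_trans (defect1_bounded g n1 (ler0n R K')).
apply: le_Rint; first exact: (bounded_meas_integrable P (bounded_family_bounded_meas g bS1)).
- exact: (bounded_meas_integrable P (min_bounded_meas g n1 (ler0n R K'))).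
move=> w; rewrite /truncation -mulr_suml ler_piMl// le_min ler0n andbT.
exact: defect_ge0.
Qed.

End CommutatorDefect.

(** * Admissible words and points *)

Lemma iter_left_shift i x j : iter i left_shift x j = x (j + i)%N.
Proof.
by elim: i j => [|i IH] j; rewrite ?addn0//= /left_shift IH addnS addSn.
Qed.

Lemma iter_Theta (T : Type) (X : shift_data T) i (w : T) x :
  iter i (Theta X) (w, x) = (iter i (base_map X) w, iter i left_shift x).
Proof. by elim: i => //= i ->. Qed.

Section Words.
Context (T : Type) (X : shift_data T).
Local Notation theta := (base_map X).
Local Notation l := (nletters X).

Lemma fiber_shift i w x : fiber X w x -> fiber X (iter i theta w) (iter i left_shift x).
Proof. by move=> xw j; rewrite !iter_left_shift -iterD addSn; exact: xw. Qed.

Lemma admissible_take w u k : admissible X w u -> admissible X w (take k u).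
Proof.
have st : (size (take k u) <= size u)%N by rewrite size_take_min geq_minr.
have nt i : (i < size (take k u))%N -> nth 0%N (take k u) i = nth 0%N u i.
  by move=> ik; rewrite nth_take// (leq_trans ik)// size_take_min geq_minl.
move=> [u1 u2]; split=> i ik.
  by rewrite nt//; apply: u1; exact: leq_trans st.
by rewrite !nt//; [apply: u2; exact: leq_trans st|exact: ltnW].
Qed.

Lemma fiber_admissible w x n : fiber X w x -> admissible X w (mkseq x n).
Proof.
move=> xw; split=> i; rewrite size_mkseq => ik; rewrite !nth_mkseq//; last exact: ltnW.
  by have [] := xw i.
by have [] := xw i.
Qed.

(** This is Koenig's lemma: at each time there are finitely many letters, so a
    word with arbitrarily long admissible extensions has a one-letter extension
    with the same property. *)
Lemma cylinder_nonempty w b :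
  (forall n, exists u, [/\ size u = n.+1, nth 0%N u 0 = b & admissible X w u]) ->
  cylinder X w [:: b] !=set0.
Proof.
move=> Hb.
pose Ext u := forall n, exists v, size v = n /\ admissible X w (u ++ v).
have extb : Ext [:: b].
  move=> n; have [[|b' v] []] := Hb n => //= -[sv] bb adm.
  by exists v; rewrite -bb.
have ext_step u : Ext u -> exists j, Ext (rcons u j).
  move=> Eu; apply: contrapT => /forallNP nE.
  have {nE} /choice[f fP] : forall j, exists n, forall v,
      size v = n -> ~ admissible X w (rcons u j ++ v).
    move=> j; have /existsNP[n nj] := nE j; exists n => v sv av.
    by apply: nj; exists v.
  pose L := l (iter (size u) theta w).
  have [v [sv av]] := Eu (\max_(j < L) f j).+1.
  case: v sv av => [|j v] //= -[sv] av.
  have jL : (j < L)%N.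
    have [H _] := av; have := H (size u).
    by rewrite nth_cat ltnn subnn size_cat /= addnS ltnS leq_addr => /(_ isT).
  have fv : (f j <= size v)%N.
    by rewrite sv; exact: (leq_bigmax (F := fun j : 'I_L => f j) (Ordinal jL)).
  apply: (fP j (take (f j) v)); first by rewrite size_takel.
  have := admissible_take (size u + (f j).+1) av.
  by rewrite take_cat ltnNge leq_addr /= addKn /= cat_rcons.
have /choice[f fP] : forall u, exists j, Ext u -> Ext (rcons u j).
  move=> u; have [/ext_step[j]|nE] := pselect (Ext u); first by exists j.
  by exists 0%N.
pose U n := iter n (fun u => rcons u (f u)) [:: b].
have sU n : size (U n) = n.+1 by elim: n => //= n IH; rewrite size_rcons IH.
have EU n : Ext (U n) by elim: n => //= n IH; exact: fP.
have aU n : admissible X w (U n).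
  have [v [_ av]] := EU n 0%N; have := admissible_take (size (U n)) av.
  by rewrite take_cat ltnn subnn take0 cats0.
have nU n k i : (i <= n)%N -> nth 0%N (U (n + k)%N) i = nth 0%N (U n) i.
  move=> ni; elim: k => [|k IH]; rewrite ?addn0// addnS /= nth_rcons sU.
  by rewrite ltnS (leq_trans ni) ?leq_addr// IH.
exists (fun i => nth 0%N (U i) i); split; last by case.
move=> i; have [u1 u2] := aU i.+1.
have E : nth 0%N (U i) i = nth 0%N (U i.+1) i by rewrite -addn1 nU.
by rewrite E; split; [apply: u1|apply: u2]; rewrite sU.
Qed.

(** Compactness makes [letter_set] a countable intersection of conditions on
    finite words, hence measurable. *)
Lemma letter_setP w b : letter_set X b w <->
  forall n, exists u, [/\ size u = n.+1, nth 0%N u 0 = b & admissible X w u].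
Proof.
split=> [[y [yw /(_ 0%N isT) /= yb]] n|/cylinder_nonempty//].
exists (mkseq y n.+1); split; first by rewrite size_mkseq.
  by rewrite nth_mkseq.
exact: fiber_admissible.
Qed.

End Words.

Lemma measurable_exists (d : measure_display) (T : measurableType d)
    (I : countType) (A : I -> set T) : (forall u, measurable (A u)) ->
  measurable [set w | exists u, A u w].
Proof.
move=> mA; rewrite (_ : [set w | _] = \bigcup_k oapp A set0 (unpickle k)).
  by apply: bigcupT_measurable => k; move: (unpickle k) => [u|] //=.
apply/seteqP; split=> w.
  by move=> [u Au]; exists (pickle u) => //; rewrite pickleK.
by move=> [k _]; move: (unpickle k) => [u|] //= Au; exists u.
Qed.

Section WordsMeasurable.
Context (R : realType) (d : measure_display) (T : measurableType d).
Context (P : probability T R) (X : shift_data T).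
Hypothesis shift : random_shift_of_finite_type P X.
Local Notation theta := (base_map X).

Lemma base_preserving : preserving P theta.
Proof. by have [[]] := shift. Qed.

Lemma base_inverse : exists hi, [/\ preserving P hi, cancel theta hi & cancel hi theta].
Proof.
have [[mt [hi [mhi tK hiK]] Pt] _ _ _ _ _ _] := shift.
exists hi; split => //; split => // A mA.
rewrite -Pt; last by rewrite -[X in measurable X]setTI; exact: mhi.
by congr (P _); apply/seteqP; split=> w /=; rewrite tK.
Qed.

Lemma measurable_iter_preimage i A : measurable A -> measurable (iter i theta @^-1` A).
Proof.
move=> mA; have [mi _] := preserving_iter i base_preserving.
by rewrite -[X in measurable X]setTI; exact: mi.
Qed.

Lemma measurable_letter_lt b : measurable [set w | (b < nletters X w)%N].
Proof.
have [_ _ ml _ _ _ _] := shift.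
have := ml measurableT [set n | (b < n)%N]; rewrite setTI; exact.
Qed.

Lemma measurable_transition i j : measurable
  [set w | [/\ (i < nletters X w)%N, (j < nletters X (theta w))%N & transition X w i j]].
Proof.
have [_ _ _ _ mt _ _] := shift.
have mD : measurable [set w | (i < nletters X w)%N /\ (j < nletters X (theta w))%N].
  apply: measurableI; first exact: measurable_letter_lt.
  exact: (measurable_iter_preimage 1 (measurable_letter_lt j)).
have := mt i j mD [set true] I; congr measurable.
by apply/seteqP; split=> w /=; [move=> [[]]|move=> []].
Qed.

Lemma measurable_imply_bool (c : bool) (A : set T) : measurable A ->
  measurable [set w | c -> A w].
Proof.
move=> mA; case: c.
  by rewrite (_ : [set w | _] = A)//; apply/seteqP; split=> w /=; [exact|].
by rewrite (_ : [set w | _] = setT)//; apply/seteqP; split.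
Qed.

Lemma measurable_and_bool (c : bool) (A : set T) : measurable A ->
  measurable [set w | c /\ A w].
Proof.
move=> mA; case: c.
  have -> : [set w | true /\ A w] = A by apply/seteqP; split=> w /=; [case|split].
  by [].
by have -> : [set w | false /\ A w] = set0 by apply/seteqP; split=> w //= -[].
Qed.

Lemma measurable_admissible u : measurable [set w | admissible X w u].
Proof.
rewrite (_ : [set w | _] =
  \bigcap_i ([set w | (i < size u)%N -> (nth 0%N u i < nletters X (iter i theta w))%N] `&`
    [set w | (i.+1 < size u)%N ->
      [/\ (nth 0%N u i < nletters X (iter i theta w))%N,
          (nth 0%N u i.+1 < nletters X (theta (iter i theta w)))%N &
          transition X (iter i theta w) (nth 0%N u i) (nth 0%N u i.+1)]])); last first.
  apply/seteqP; split=> w /=.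
    move=> [u1 u2] i _; split=> /= iu; first exact: u1.
    by split; [apply: u1; exact: ltnW|exact: (u1 i.+1)|exact: u2].
  by move=> H; split=> i iu; [case: (H i I) => /= + _; apply|case: (H i I) => /= _ /(_ iu)[]].
apply: bigcapT_measurable => i; apply: measurableI; apply: measurable_imply_bool.
  exact: (measurable_iter_preimage i (measurable_letter_lt _)).
exact: (measurable_iter_preimage i (measurable_transition _ _)).
Qed.

Lemma measurable_letter_set b : measurable (letter_set X b).
Proof.
rewrite (_ : letter_set X b = \bigcap_n [set w | exists u,
    ((size u == n.+1) && (nth 0%N u 0 == b)) /\ admissible X w u]).
  apply: bigcapT_measurable => n.
  apply: (measurable_exists (A := fun u => [set w | _ /\ admissible X w u])) => u.
  exact: (measurable_and_bool _ (measurable_admissible u)).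
apply/seteqP; split=> w.
  move=> /letter_setP H n _; have [u [su ub au]] := H n.
  by exists u; split => //; rewrite su ub !eqxx.
move=> H; apply/letter_setP => n; have [u [/andP[/eqP su /eqP ub] au]] := H n I.
by exists u.
Qed.

(** Almost surely every point of a fiber starts with an essential letter, so the
    alphabet contains a letter that is at least the least essential one; alphabets
    are initial segments. *)
Lemma least_essential_letter : exists a, essential_letter P X a /\
  {ae P, forall w, (a < nletters X w)%N}.
Proof.
have aeE : {ae P, forall w, forall b, ~ essential_letter P X b -> ~ letter_set X b w}.
  apply: ae_forall_nat => b; have [eb|neb] := pselect (essential_letter P X b).
    by apply: aeW => w.
  have P0 : P (letter_set X b) = 0%E.
    by apply/eqP; rewrite eq_le measure_ge0 andbT leNgt; apply/negP.
  exists (letter_set X b); split => //; first exact: measurable_letter_set.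
  by move=> w /= H; apply: contrapT => nb; apply: H.
have aeF : {ae P, forall w, exists2 b, essential_letter P X b & letter_set X b w}.
  have [_ _ _ _ _ ne _] := shift.
  apply: filterS2 aeE ne => w wE [x xw].
  have lw : letter_set X (x 0%N) w by exists x; split => // -[].
  exists (x 0%N) => //; apply: contrapT => nb; exact: wE _ nb lw.
have [b eb] : exists b, essential_letter P X b.
  apply: contrapT => nb; have : (P setT = 0)%E.
    apply/negligibleP => //; move: aeF; apply: negligibleS => w _ /= [b eb _].
    by apply: nb; exists b.
  by rewrite probability_setT => -[/eqP]; rewrite oner_eq0.
have exb : exists b, `[< essential_letter P X b >] by exists b; apply/asboolP.
exists (ex_minn exb); case: ex_minnP => a /asboolP ea amin; split => //.
apply: filterS aeF => w [c ec [y [yw /(_ 0%N isT) /= yc]]].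
apply: (@leq_ltn_trans c); first by apply: amin; apply/asboolP.
by have [+ _] := yw 0%N; rewrite yc.
Qed.

End WordsMeasurable.

(** * Loops and a measurable choice of points *)

Section Loops.
Context (T : Type) (X : shift_data T) (a : nat).
Local Notation theta := (base_map X).
Local Notation l := (nletters X).

Definition loop (w : T) (u : seq nat) : Prop := words_from_to X (size u) a a w u.

Lemma loopP w u : loop w u <->
  [/\ (0 < size u)%N, nth 0%N u 0 = a & admissible X w (rcons u a)].
Proof.
rewrite /loop /words_from_to /words; case/lastP: u => [|u c].
  by split=> [[_ //]|[]].
rewrite /mkset last_rcons size_rcons /=.
have n1 i : (i < (size u).+1)%N -> nth 0%N (rcons (rcons u c) a) i = nth 0%N (rcons u c) i.
  by move=> iu; rewrite nth_rcons size_rcons iu.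
have nc : nth 0%N (rcons (rcons u c) a) (size u) = c.
  by rewrite n1// nth_rcons ltnn eqxx.
have na : nth 0%N (rcons (rcons u c) a) (size u).+1 = a.
  by rewrite nth_rcons size_rcons ltnn eqxx.
have hd : ohead (rcons u c) = Some (nth 0%N (rcons u c) 0) by case: (u).
rewrite hd; split.
  move=> [[_ [u1 u2]] [ua] [v1 v2]]; split => //; split=> i.
    rewrite !size_rcons !ltnS leq_eqVlt => /predU1P[->|iu].
      rewrite na; have := v1 1%N isT; rewrite /= -iterS; exact.
    by rewrite n1//; apply: u1; rewrite ?size_rcons.
  rewrite !size_rcons !ltnS leq_eqVlt => /predU1P[->|iu].
    by rewrite nc na; exact: (v2 0%N isT).
  by rewrite !n1 ?ltnS// 1?ltnW//; apply: u2; rewrite ?size_rcons.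
move=> [_ ua [v1 v2]]; rewrite !size_rcons in v1 v2; split.
- split => //; split=> i; rewrite ?size_rcons => iu.
    by rewrite -n1//; apply: v1; exact: ltnW.
  by rewrite -!n1 ?(ltnW iu)//; apply: v2; exact: ltnW.
- by rewrite ua.
- split=> [[|[|i]]|[|i]] //= _.
  + by have := v1 (size u); rewrite nc; apply; rewrite ltnS ltnW.
  + by have := v1 (size u).+1; rewrite na; apply.
  + by have := v2 (size u); rewrite nc na; apply.
Qed.

Definition glue (u : seq nat) (s : nat -> nat) : nat -> nat :=
  fun i => if (i < size u)%N then nth 0%N u i else s (i - size u)%N.

Lemma glue_cat u v s : glue (u ++ v) s = glue u (glue v s).
Proof.
apply/funext => i; rewrite /glue size_cat nth_cat.
have [iu|iu] := ltnP i (size u); first by rewrite (leq_trans iu) ?leq_addr.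
by rewrite ltn_subLR// subnDA.
Qed.

Lemma glue_shift u s : iter (size u) left_shift (glue u s) = s.
Proof.
apply/funext => i; rewrite iter_left_shift /glue ltnNge leq_addl /= addnK //.
Qed.

Lemma glue_nth u s i : (i < size u)%N -> glue u s i = nth 0%N u i.
Proof. by rewrite /glue => ->. Qed.

Lemma loop_fiber w u s : loop w u -> fiber X (iter (size u) theta w) s ->
  s 0%N = a -> fiber X w (glue u s).
Proof.
move=> /loopP[u0 ua [v1 v2]] fs sa i; rewrite size_rcons in v1 v2.
have E j : (j <= size u)%N -> glue u s j = nth 0%N (rcons u a) j.
  rewrite leq_eqVlt nth_rcons /glue => /predU1P[->|ju]; last by rewrite ju.
  by rewrite ltnn eqxx subnn.
have [iu|ui] := ltnP i (size u).
  by rewrite !E//; [split; [exact/v1/ltnW|exact: v2]|exact: ltnW].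
have := fs (i - size u)%N; rewrite -iterD subnK// /glue.
by rewrite !ltnNge ui (leq_trans ui)//= subSn.
Qed.

Lemma fiber_loop w u s : (0 < size u)%N -> nth 0%N u 0 = a -> s 0%N = a ->
  fiber X w (glue u s) -> loop w u.
Proof.
move=> u0 ua sa fw; apply/loopP; split => //.
have := fiber_admissible (size u).+1 fw; congr admissible.
apply: (@eq_from_nth _ 0%N); rewrite size_mkseq ?size_rcons// => i.
rewrite ltnS => iu; rewrite nth_mkseq// nth_rcons /glue.
by move: iu; rewrite leq_eqVlt => /predU1P[->|->//]; rewrite ltnn eqxx subnn.
Qed.

Lemma loop_letters w u i : loop w u -> (i < size u)%N ->
  (nth 0%N u i < l (iter i theta w))%N.
Proof. by move=> [[_ [u1 _]] _ _] iu; exact: u1. Qed.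

(** Repeated loops give a point of the fiber that depends on countably many
    choices of finite words only; this is what makes it measurable in [w]. *)
Lemma loops_fiber (N : nat) (U : T -> seq nat) w : (0 < N)%N ->
  (forall i, loop (iter i theta w) (U (iter i theta w)) /\
     size (U (iter i theta w)) = N) ->
  fiber X w (fun i => nth 0%N (U (iter (i %/ N * N) theta w)) (i %% N)).
Proof.
move=> N0 UP i; set q := (i %/ N)%N; set r := (i %% N)%N.
have rN : (r < N)%N by rewrite ltn_mod.
have iE : i = (r + q * N)%N by rewrite addnC -divn_eq.
have [/loopP[_ _ [u1 u2]] su] := UP (q * N)%N.
have U0 k : nth 0%N (U (iter k theta w)) 0 = a by have [/loopP[]] := UP k.
rewrite size_rcons su in u1 u2; move: u1 u2; set u := U _ => u1 u2.
have E : nth 0%N (rcons u a) r = nth 0%N u r by rewrite nth_rcons su rN.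
have E' : nth 0%N (rcons u a) r.+1 =
    nth 0%N (U (iter (i.+1 %/ N * N) theta w)) (i.+1 %% N).
  have [rN1|rN1] := ltnP r.+1 N.
    rewrite nth_rcons su rN1; have -> : (i.+1 = q * N + r.+1)%N by rewrite iE addnC addnS.
    by rewrite divnMDl// modnMDl divn_small// modn_small// addn0.
  have rE : r.+1 = N by apply/eqP; rewrite eqn_leq rN1 rN.
  have -> : (i.+1 = q.+1 * N)%N by rewrite iE -addSn rE mulSn.
  by rewrite mulnK// modnMl U0 rE nth_rcons su ltnn eqxx.
rewrite -E -E' iE iterD; split; [apply: u1|exact: u2].
exact: ltnW.
Qed.

End Loops.

(** * Measurable selection *)

Section Selection.
Context (d : measure_display) (T : measurableType d).

(** Choose the first admissible index in an enumeration. *)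
Lemma countable_selection (I : countType) (i0 : I) (D : I -> set T) :
  (forall i, measurable (D i)) ->
  exists U : T -> I, (forall w i, D i w -> D (U w) w) /\
    forall A : set I, measurable (U @^-1` A).
Proof.
move=> mD.
pose F i := D i `&` ~` [set w | exists j, (pickle j < pickle i)%N /\ D j w].
have mF i : measurable (F i).
  apply: measurableI => //; apply: measurableC.
  apply: (measurable_exists (A := fun j => [set w | (pickle j < pickle i)%N /\ D j w])) => j.
  exact: measurable_and_bool.
have Funiq w i j : F i w -> F j w -> i = j.
  move=> [Di Fi] [Dj Fj]; apply: (pcan_inj pickleK_inv); apply/eqP.
  rewrite -[_ == _]negbK neq_ltn; apply/negP => /orP[ij|ji].
    by apply: Fj; exists i.
  by apply: Fi; exists j.
have Fex w i : D i w -> exists j, F j w.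
  move: {2}(pickle i).+1 (ltnSn (pickle i)) => n; elim: n i => // n IH i.
  rewrite ltnS => ni Di; have [[j [ji Dj]]|nj] := pselect (exists j, (pickle j < pickle i)%N /\ D j w).
    by apply: (IH j) => //; exact: leq_trans ni.
  by exists i; split.
pose U w := xget i0 [set i | F i w].
have UF w i : F i w -> U w = i by move=> Fi; apply: xget_unique => // j Fj; exact: Funiq Fj Fi.
exists U; split=> [w i /Fex[j Fj]|A]; first by rewrite (UF _ _ Fj); case: Fj.
rewrite (_ : U @^-1` A = [set w | exists i, `[< A i >] /\ F i w] `|`
   [set w | `[< A i0 >] /\ (~` [set w | exists i, F i w]) w]).
  apply: measurableU.
    apply: (measurable_exists (A := fun i => [set w | `[< A i >] /\ F i w])) => i.
    exact: measurable_and_bool.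
  apply: measurable_and_bool; apply: measurableC; exact: measurable_exists.
apply/seteqP; split=> w /=.
  have [[i Fi]|nF] := pselect (exists i, F i w).
    by rewrite (UF _ _ Fi) => Ai; left; exists i; split => //; apply/asboolP.
  rewrite /U; case: xgetP => [i _ Fi|_ Ai]; first by case: nF; exists i.
  by right; split => //; apply/asboolP.
move=> [[i [/asboolP Ai Fi]]|[/asboolP Ai nF]]; first by rewrite (UF _ _ Fi).
by rewrite /U; case: xgetP => // i _ Fi; case: nF; exists i.
Qed.

Lemma measurable_sequences (F : T -> nat -> nat) :
  (forall i j, measurable [set w | F w i = j]) ->
  measurable_fun [set: T] (F : T -> sequences).
Proof.
move=> mF; apply: (@measurability _ _ _ sequences _ _ coordinate_sets) => //.
by move=> _ [_ [i [j ->]] <-]; rewrite setTI; exact: mF.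
Qed.

Lemma measurable_coordinate i j : measurable [set x : sequences | x i = j].
Proof. by apply: sub_sigma_algebra; exists i, j. Qed.

Lemma measurable_left_shift i :
  measurable_fun [set: sequences] (iter i left_shift : sequences -> sequences).
Proof.
apply: (@measurability _ _ _ sequences _ _ coordinate_sets) => //.
move=> _ [_ [k [j ->]] <-]; rewrite setTI.
rewrite (_ : _ @^-1` _ = [set x : sequences | x (k + i)%N = j]).
  exact: measurable_coordinate.
by apply/seteqP; split=> x /=; rewrite iter_left_shift.
Qed.

End Selection.

(** * Sums over countable index sets *)

Section SumsOverSets.
Context (R : realType).
Local Open Scope ereal_scope.

Lemma esum_seq (I : choiceType) (V : seq I) (F : I -> \bar R) : uniq V ->
  (forall i, 0 <= F i) -> \esum_(i in [set` V]) F i = \sum_(i <- V) F i.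
Proof.
move=> uV F0; rewrite esum_fset; [by rewrite -fsbig_seq|exact: finite_seq|].
by move=> i _; exact: F0.
Qed.

Lemma esum_subset (I : choiceType) (S S' : set I) (F : I -> \bar R) :
  S `<=` S' -> \esum_(i in S) F i <= \esum_(i in S') F i.
Proof.
move=> SS'; apply: ge_ereal_sup => _ [A [finA AS] <-].
by apply: ereal_sup_ubound; exists A => //; split => //; exact: subset_trans AS SS'.
Qed.

Lemma esumZl (I : choiceType) (S : set I) (F : I -> \bar R) (c : R) :
  (0 <= c)%R -> (forall i, 0 <= F i) ->
  \esum_(i in S) (c%:E * F i) = c%:E * \esum_(i in S) F i.
Proof.
have half (b : R) (H : I -> \bar R) : (0 < b)%R -> (forall i, 0 <= H i) ->
    \esum_(i in S) (b%:E * H i) <= b%:E * \esum_(i in S) H i.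
  move=> b0 H0; apply: ge_ereal_sup => _ [A [finA AS] <-].
  rewrite -ge0_mule_fsumr//; apply: lee_wpmul2l; first by rewrite lee_fin ltW.
  by apply: ereal_sup_ubound; exists A.
rewrite le_eqVlt => /predU1P[<-|c0] F0.
  by rewrite mul0e esum1// => i _; rewrite mul0e.
apply/eqP; rewrite eq_le half//=.
rewrite -[leRHS]mul1e -(divff (lt0r_neq0 c0)) EFinM -muleA; apply: lee_wpmul2l.
  by rewrite lee_fin ltW.
have -> : \esum_(i in S) F i = \esum_(i in S) ((c^-1)%:E * (c%:E * F i)).
  by apply: eq_esum => i _; rewrite muleA -EFinM mulVf ?mul1e// lt0r_neq0.
apply: half; first by rewrite invr_gt0.
by move=> i; rewrite mule_ge0// lee_fin ltW.
Qed.

Lemma measurable_esum (d : measure_display) (T : measurableType d)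
    (I : countType) (F : I -> T -> \bar R) (S : set I) :
  (forall i, measurable_fun [set: T] (F i)) -> (forall i w, 0 <= F i w) ->
  measurable_fun [set: T] (fun w => \esum_(i in S) F i w).
Proof.
move=> mF F0.
have [[i0 Si0]|S0] := pselect (S !=set0); last first.
  have -> : S = set0 by apply/seteqP; split=> // i Si; apply: S0; exists i.
  by under eq_fun do rewrite esum_set0; exact: measurable_cst.
pose e (k : nat) := odflt i0 (@pickle_inv I k).
pose Q := [set k | exists2 i, S i & k = pickle i].
have eP i : e (pickle i) = i by rewrite /e pickleK_inv.
have SE : S = [set e k | k in Q].
  apply/seteqP; split=> [i Si|_ [_ [i Si ->] <-]]; last by rewrite eP.
  by exists (pickle i); [exists i|rewrite eP].
have inj : set_inj Q e.
  by move=> k k' /set_mem[i _ ->] /set_mem[j _ ->]; rewrite !eP => ->.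
rewrite (_ : (fun w => _) = fun w => \sum_(0 <= k <oo | k \in Q) F (e k) w).
  exact: ge0_emeasurable_sum.
by apply/funext => w; rewrite [in LHS]SE (esum_set_image (F^~ w) e Q).
Qed.

End SumsOverSets.

(** * Weights of loops *)

Section Cocycle.
Context (G : groupType) (psi : (nat -> nat) -> G).
Hypothesis psi0 : depends_on_first_coordinate psi.

Lemma cocycle_word_cat u v :
  cocycle_word psi (u ++ v) = (cocycle_word psi u * cocycle_word psi v)%g.
Proof.
rewrite /cocycle_word /cocycle size_cat big_split_ord /=.
congr (_ * _)%g; apply: eq_bigr => i _; apply: psi0; rewrite !iter_left_shift !add0n nth_cat.
  by rewrite ltn_ord.
by rewrite ltnNge leq_addr /= addKn.
Qed.

Lemma cocycle_word_ab u :
  cocycle_word (fun x => ab_proj (psi x)) u = ab_proj (cocycle_word psi u).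
Proof.
rewrite /cocycle_word /cocycle; apply: (big_ind2 (fun x y => x = ab_proj y)) => //.
by move=> x1 x2 y1 y2 -> ->; rewrite -ab_mulE.
Qed.

Lemma cocycle_word_ab1 u : cocycle_word (fun x => ab_proj (psi x)) u = 1%g <->
  commutator_subgroup (cocycle_word psi u).
Proof.
rewrite cocycle_word_ab; have [_ _ CV] := commutator_subgroupP G.
rewrite -[1%g]/(ab_proj 1%g) ab_projP mulg1.
by split=> /CV; rewrite ?invgK.
Qed.

End Cocycle.

Section Weights.
Context (R : realType) (d : measure_display) (T : measurableType d).
Context (P : probability T R) (X : shift_data T).
Hypothesis shift : random_shift_of_finite_type P X.
Local Notation theta := (base_map X).
Context (phi : T * (nat -> nat) -> R).
Hypothesis mphi : measurable_fun (total_space X : set (T * sequences)) phi.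
Context (kappa : T -> nat).
Context (a : nat) (s : T -> nat -> nat).

(** The invariance of [Reg] ensures that the almost sure properties hold along
    entire orbits; [s] is the choice of a point starting with [a] in each fiber. *)
Record regular_set (Reg : set T) : Prop := RegularSet {
  regular_inv : forall w, Reg (theta w) <-> Reg w;
  regular_Holder : forall w, Reg w -> forall n, (1 <= n)%N ->
    (fiber_variation X n phi w <= ((kappa w)%:R * 2 ^- n)%:E)%E;
  regular_fin : forall w, Reg w -> fiber_sup_norm X phi w \is a fin_num;
  regular_point : forall w, Reg w -> fiber X w (s w) /\ s w 0%N = a }.

Context (Reg : set T).
Hypothesis reg : regular_set Reg.
Hypothesis ms : forall i j, measurable [set w | s w i = j].

Lemma regular_iter i w : Reg (iter i theta w) <-> Reg w.
Proof. by elim: i => // i IH; rewrite iterS (regular_inv reg). Qed.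

Local Notation S := (birkhoff_sum X phi).

Lemma birkhoff_sumD n k w y :
  S (n + k) w y = S n w y + S k (iter n theta w) (iter n left_shift y).
Proof.
rewrite /birkhoff_sum big_split_ord /=; congr (_ + _); apply: eq_bigr => i _.
by rewrite -iter_Theta -iterD addnC.
Qed.

Definition distortion (n : nat) (w : T) : R :=
  \sum_(i < n) (kappa (iter i theta w))%:R * 2 ^- (n - i).

Lemma birkhoff_distortion n w y y' : Reg w -> fiber X w y -> fiber X w y' ->
  (forall i, (i < n)%N -> y i = y' i) -> `|S n w y - S n w y'| <= distortion n w.
Proof.
move=> Ow fy fy' E; rewrite /birkhoff_sum -sumrB.
apply: le_trans (ler_norm_sum _ _ _) _; apply: ler_sum => i _.
have Oi : Reg (iter i theta w) by apply/regular_iter.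
have ni : (1 <= n - i)%N by rewrite subn_gt0.
rewrite -lee_fin; apply: le_trans (regular_Holder reg Oi ni); apply: ereal_sup_ubound.
rewrite !iter_Theta; exists (iter i left_shift y), (iter i left_shift y'); split => //.
- exact: fiber_shift.
- exact: fiber_shift.
- by move=> j; rewrite ltn_subRL addnC => jn; rewrite !iter_left_shift E.
Qed.

Definition sup_norm (w : T) : R := fine (fiber_sup_norm X phi w).

Lemma sup_norm_ge0 w : Reg w -> 0 <= sup_norm w.
Proof.
move=> Ow; have [fs _] := regular_point reg Ow; rewrite -lee_fin fineK ?(regular_fin reg)//.
by apply: le_trans (ereal_sup_ubound _); last (by exists (s w)); rewrite lee_fin.
Qed.

Lemma birkhoff_norm n w y : Reg w -> fiber X w y ->
  `|S n w y| <= \sum_(i < n) sup_norm (iter i theta w).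
Proof.
move=> Ow fy; rewrite /birkhoff_sum.
apply: le_trans (ler_norm_sum _ _ _) _; apply: ler_sum => i _.
have Oi : Reg (iter i theta w) by apply/regular_iter.
rewrite -lee_fin fineK ?(regular_fin reg)//; apply: ereal_sup_ubound.
by exists (iter i left_shift y); [exact: fiber_shift|rewrite iter_Theta].
Qed.

(** The potential is measurable on the total space only. *)
Definition cut_phi : T * sequences -> R := phi \_ (total_space X).

Lemma measurable_total_space : measurable (total_space X : set (T * sequences)).
Proof.
rewrite (_ : total_space X = \bigcap_i [set p | exists jk : nat * nat,
    (fst @^-1` (iter i theta @^-1` [set w | [/\ (jk.1 < nletters X w)%N,
        (jk.2 < nletters X (theta w))%N & transition X w jk.1 jk.2]]) `&`
     (snd @^-1` ([set x : sequences | x i = jk.1] `&` [set x : sequences | x i.+1 = jk.2]))) p]).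
  apply: bigcapT_measurable => i.
  apply: (measurable_exists (A := fun jk : nat * nat => _ `&` _)) => jk.
  apply: measurableI; rewrite -[X in measurable X]setTI.
    apply: measurable_fst => //.
    exact: (measurable_iter_preimage shift i (measurable_transition shift _ _)).
  by apply: measurable_snd => //; apply: measurableI; exact: measurable_coordinate.
apply/seteqP; split=> -[w x] /=.
  move=> fx i _; exists (x i, x i.+1) => /=; split => //=.
  by split; [case: (fx i)|case: (fx i.+1)|case: (fx i)].
by move=> H i; have [[j k] /= [[jl kl tr] [-> ->]]] := H i I.
Qed.

Lemma measurable_cut_phi : measurable_fun [set: T * sequences] cut_phi.
Proof. exact/(measurable_restrictT _ measurable_total_space). Qed.

Lemma cut_phiE w y : fiber X w y -> cut_phi (w, y) = phi (w, y).
Proof. by move=> fy; rewrite /cut_phi patchT// inE. Qed.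

Lemma birkhoff_cut n w y : fiber X w y -> birkhoff_sum X cut_phi n w y = S n w y.
Proof.
move=> fy; apply: eq_bigr => i _; rewrite !iter_Theta cut_phiE//.
exact: fiber_shift.
Qed.

(** Birkhoff sums are taken at this point of the cylinder of [u], and not as a
    supremum over the cylinder, so that weights are measurable in [w]. *)
Definition word_point (w : T) (u : seq nat) : nat -> nat :=
  glue u (s (iter (size u) theta w)).

Definition word_weight (u : seq nat) (w : T) : R :=
  expR (birkhoff_sum X cut_phi (size u) w (word_point w u)).

Lemma measurable_word_point u :
  measurable_fun [set: T] ((fun w => word_point w u) : T -> sequences).
Proof.
apply: measurable_sequences => i j; rewrite /word_point /glue.
have [iu|iu] := ltnP i (size u).
  have -> : [set w | nth 0%N u i = j] = [set w | (nth 0%N u i == j) /\ [set: T] w].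
    by apply/seteqP; split=> w /= => [->|[/eqP]].
  exact: measurable_and_bool.
exact: (measurable_iter_preimage shift (size u) (ms (i - size u) j)).
Qed.

Lemma measurable_word_weight u : measurable_fun [set: T] (word_weight u).
Proof.
rewrite /word_weight /birkhoff_sum; apply: (measurableT_comp (@measurable_expR R)).
apply: (@measurable_sum _ _ _ _ _ _ (fun (i : 'I_(size u)) (w : T) =>
  cut_phi (iter i (Theta X) (w, word_point w u)))) => i.
under eq_fun do rewrite iter_Theta.
apply: (measurableT_comp measurable_cut_phi); apply: measurable_fun_pair.
  by have [] := preserving_iter i (base_preserving shift).
exact: (measurableT_comp (measurable_left_shift i) (measurable_word_point u)).
Qed.

Lemma measurable_loop u : measurable [set w | loop X a w u].
Proof.
rewrite (_ : [set w | _] = [set w | ((0 < size u)%N && (nth 0%N u 0 == a)) /\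
    admissible X w (rcons u a)]).
  exact/measurable_and_bool/(measurable_admissible shift).
apply/seteqP; split=> w.
  by move=> /loopP[u0 /eqP ua au]; split => //; rewrite u0 ua.
by move=> [/andP[u0 /eqP ua] au]; apply/loopP.
Qed.

Lemma word_point_fiber w u : Reg w -> loop X a w u -> fiber X w (word_point w u).
Proof.
move=> Ow lu; have /(regular_point reg)[fs sa] : Reg (iter (size u) theta w) by apply/regular_iter.
exact: loop_fiber lu fs sa.
Qed.

Lemma loop_cat w u v : Reg w -> loop X a w u -> loop X a (iter (size u) theta w) v ->
  loop X a w (u ++ v).
Proof.
move=> Ow lu lv; have Ou : Reg (iter (size u) theta w) by apply/regular_iter.
have /(regular_point reg)[fs sa] : Reg (iter (size v) theta (iter (size u) theta w)) by apply/regular_iter.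
have fv := loop_fiber lv fs sa; have [u0 ua _] := (loopP _ _ _ _).1 lu.
have [v0 va _] := (loopP _ _ _ _).1 lv.
apply: (fiber_loop (s := s (iter (size v) theta (iter (size u) theta w)))) => //.
- by rewrite size_cat addn_gt0 u0.
- by rewrite nth_cat u0.
rewrite glue_cat; apply: loop_fiber lu fv _; by rewrite glue_nth.
Qed.

(** The points chosen for [u] and for [u ++ v] agree along [u]. *)
Lemma word_weight_cat w u v : Reg w -> loop X a w u ->
  loop X a (iter (size u) theta w) v ->
  expR (- distortion (size u) w) *
    (word_weight u w * word_weight v (iter (size u) theta w)) <= word_weight (u ++ v) w.
Proof.
move=> Ow lu lv; have Ou : Reg (iter (size u) theta w) by apply/regular_iter.
have luv := loop_cat Ow lu lv.
rewrite /word_weight !birkhoff_cut; try exact: word_point_fiber.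
rewrite -!expRD ler_expR size_cat birkhoff_sumD.
have E : word_point w (u ++ v) = glue u (word_point (iter (size u) theta w) v).
  by rewrite /word_point glue_cat size_cat addnC iterD.
rewrite {2}E glue_shift.
have := birkhoff_distortion Ow (word_point_fiber Ow lu) (word_point_fiber Ow luv) (n := size u).
rewrite ler_norml => H; have /H/andP[_] : forall i, (i < size u)%N ->
    word_point w u i = word_point w (u ++ v) i.
  by move=> i iu; rewrite E /word_point !glue_nth.
by lra.
Qed.

Lemma birkhoff_word_weight w u y : Reg w -> loop X a w u -> cylinder X w u y ->
  expR (S (size u) w y) <= expR (distortion (size u) w) * word_weight u w.
Proof.
move=> Ow lu [fy yE].
rewrite /word_weight birkhoff_cut; last exact: word_point_fiber.
rewrite -expRD ler_expR -lerBlDr.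
have : forall i, (i < size u)%N -> y i = word_point w u i.
  by move=> i iu; rewrite yE// /word_point glue_nth.
move/(birkhoff_distortion Ow fy (word_point_fiber Ow lu)).
by rewrite ler_norml => /andP[_].
Qed.

Lemma word_weight_le w u : Reg w -> loop X a w u -> ((word_weight u w)%:E <=
  expeR (ereal_sup [set (S (size u) w y)%:E | y in cylinder X w u]))%E.
Proof.
move=> Ow lu; rewrite /word_weight birkhoff_cut; last exact: word_point_fiber.
rewrite -[leLHS]/(expeR (S _ _ _)%:E) lee_expeR; apply: ereal_sup_ubound.
exists (word_point w u) => //; split; first exact: word_point_fiber.
by move=> i iu; rewrite /word_point glue_nth.
Qed.

Lemma word_weight_ge w u : Reg w -> loop X a w u ->
  expR (- \sum_(i < size u) sup_norm (iter i theta w)) <= word_weight u w.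
Proof.
move=> Ow lu; rewrite /word_weight birkhoff_cut; last exact: word_point_fiber.
rewrite ler_expR; have := birkhoff_norm (size u) Ow (word_point_fiber Ow lu).
by rewrite ler_norml => /andP[].
Qed.

End Weights.

(** * The Green function of the extension *)

Section Green.
Context (R : realType) (d : measure_display) (T : measurableType d).
Context (P : probability T R) (X : shift_data T).
Hypothesis shift : random_shift_of_finite_type P X.
Local Notation theta := (base_map X).
Context (phi : T * (nat -> nat) -> R).
Hypothesis mphi : measurable_fun (total_space X : set (T * sequences)) phi.
Context (kappa : T -> nat) (a : nat) (s : T -> nat -> nat) (Reg : set T).
Hypothesis reg : regular_set X phi kappa a s Reg.
Hypothesis ms : forall i j, measurable [set w | s w i = j].
Context (G : groupType) (psi : (nat -> nat) -> G).
Hypothesis psi0 : depends_on_first_coordinate psi.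
Context (t : R).
Local Notation weight u w := (word_weight X phi s u w).

Definition loop_term (u : seq nat) (w : T) : R :=
  if `[< loop X a w u >] then expR (- (t * (size u)%:R)) * weight u w else 0.

Lemma loop_term_ge0 u w : 0 <= loop_term u w.
Proof. by rewrite /loop_term; case: ifP => // _; rewrite mulr_ge0 ?expR_ge0. Qed.

Lemma loop_termE u w : loop X a w u ->
  loop_term u w = expR (- (t * (size u)%:R)) * weight u w.
Proof. by move=> lu; rewrite /loop_term asboolT. Qed.

Lemma measurable_loop_term u : measurable_fun [set: T] (loop_term u).
Proof.
apply: measurable_fun_ifT => //.
  apply: (measurable_fun_bool true); rewrite setTI.
  rewrite (_ : _ @^-1` _ = [set w | loop X a w u]); first exact: (measurable_loop shift).
  by apply/seteqP; split=> w /= => /asboolP.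
apply: measurable_funM => //; exact: (measurable_word_weight shift).
Qed.

(** The Green function from the identity to [g] of the random walk on the group
    driven by the loops, discounted at rate [t]. *)
Definition green (g : G) (w : T) : \bar R :=
  \esum_(u in [set u | cocycle_word psi u = g]) (loop_term u w)%:E.

Lemma measurable_green g : measurable_fun [set: T] (green g).
Proof.
apply: measurable_esum => [u|u w]; last by rewrite lee_fin loop_term_ge0.
by apply/measurable_EFinP; exact: measurable_loop_term.
Qed.

Lemma green_ge0 g w : (0 <= green g w)%E.
Proof. by apply: esum_ge0 => u _; rewrite lee_fin loop_term_ge0. Qed.

Lemma green_ge_term u w : ((loop_term u w)%:E <= green (cocycle_word psi u) w)%E.
Proof.
rewrite -(esum_set1 (a := fun u => (loop_term u w)%:E)) ?lee_fin ?loop_term_ge0//.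
by apply: esum_subset => _ ->.
Qed.

Lemma loop_term_cat u v w : Reg w ->
  expR (- distortion R X kappa (size u) w) *
    (loop_term u w * loop_term v (iter (size u) theta w)) <= loop_term (u ++ v) w.
Proof.
move=> Rw; have [lu|nu] := pselect (loop X a w u); last first.
  by rewrite {1}/loop_term asboolF// mul0r mulr0 loop_term_ge0.
have [lv|nv] := pselect (loop X a (iter (size u) theta w) v); last first.
  by rewrite {2}/loop_term asboolF// !mulr0 loop_term_ge0.
rewrite !loop_termE//; last exact: (loop_cat reg).
have := word_weight_cat reg Rw lu lv.
rewrite size_cat natrD mulrDr opprD expRD => H.
have := expR_gt0 (- (t * (size u)%:R)); have := expR_gt0 (- (t * (size v)%:R)).
set x := expR (- (t * _)); set y := expR (- (t * _)) => y0 x0.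
apply: le_trans (ler_wpM2l (mulr_ge0 (ltW x0) (ltW y0)) H).
by rewrite le_eqVlt; apply/orP; left; apply/eqP; ring.
Qed.

(** Cutting a loop after its first [n] letters shows that [green] is
    superharmonic, up to the distortion of the first [n] steps. *)
Lemma green_superharmonic n (V : seq (seq nat)) g w : Reg w -> uniq V ->
  (forall u, u \in V -> size u = n) ->
  ((expR (- distortion R X kappa n w))%:E * \sum_(u <- V) (loop_term u w)%:E *
     green ((cocycle_word psi u)^-1 * g)%g (iter n theta w) <= green g w)%E.
Proof.
move=> Rw uV sV; set c := expR _.
have g0 u : (0 <= (loop_term u w)%:E *
    green ((cocycle_word psi u)^-1 * g)%g (iter n theta w))%E.
  by rewrite mule_ge0 ?lee_fin ?loop_term_ge0 ?green_ge0.
rewrite -(esum_seq uV g0) -esumZl ?expR_ge0//.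
pose J u := [set v | cocycle_word psi v = ((cocycle_word psi u)^-1 * g)%g].
have -> : \esum_(u in [set` V]) (c%:E * ((loop_term u w)%:E *
     green ((cocycle_word psi u)^-1 * g)%g (iter n theta w)))%E =
   \esum_(u in [set` V]) \esum_(v in J u)
     (c * (loop_term u w * loop_term v (iter n theta w)))%:E.
  apply: eq_esum => u _; rewrite /green -esumZl ?loop_term_ge0//; last first.
    by move=> v; rewrite lee_fin loop_term_ge0.
  rewrite -esumZl ?expR_ge0//.
  by move=> v; rewrite mule_ge0 ?lee_fin ?loop_term_ge0.
rewrite esum_esum; last first.
  by move=> u v _ _; rewrite lee_fin !mulr_ge0 ?expR_ge0 ?loop_term_ge0.
pose e (k : seq nat * seq nat) := k.1 ++ k.2.
apply: (@le_trans _ _ (\esum_(k in [set` V] `*`` J) (loop_term (e k) w)%:E)).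
  apply: le_esum => -[u v] [/= uu _]; rewrite lee_fin /c -(sV u uu).
  exact: loop_term_cat.
rewrite -(esum_image _ e (fun u => (loop_term u w)%:E)).
  apply: esum_subset => _ [[u v] [/= uu Jv] <-] /=.
  by rewrite /e cocycle_word_cat// Jv mulgA mulgV mul1g.
move=> [u v] [u' v'] /set_mem[/= uu _] /set_mem[/= uu' _] /eqP.
by rewrite /e /= eqseq_cat ?(sV u') ?sV// => /andP[/eqP -> /eqP ->].
Qed.

Lemma green_step u g w : Reg w -> loop X a w u ->
  ((expR (- distortion R X kappa (size u) w) * loop_term u w)%:E *
     green ((cocycle_word psi u)^-1 * g)%g (iter (size u) theta w) <= green g w)%E.
Proof.
move=> Rw lu; have := @green_superharmonic (size u) [:: u] g w Rw isT.
rewrite big_seq1 EFinM muleA; apply => u'; by rewrite inE => /eqP ->.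
Qed.

End Green.

(** * Comparison with the partition sums *)

Lemma esum_geometric (R : realType) (c : nat -> R) (r : R) (n0 : nat) :
  0 < r -> r < 1 -> (forall n, 0 <= c n) ->
  (forall n, (n0 <= n)%N -> c n <= r ^+ n) ->
  (\esum_(n in [set: nat]) (c n)%:E < +oo)%E.
Proof.
move=> r0 r1 c0 cr.
pose C := 1 + \sum_(k < n0) c k / r ^+ k.
have rn n : 0 < r ^+ n by exact: exprn_gt0.
have C0 : 0 <= \sum_(k < n0) c k / r ^+ k.
  by apply: sumr_ge0 => k _; rewrite divr_ge0// ltW.
have cC n : c n <= C * r ^+ n.
  have [nn0|n0n] := ltnP n n0.
    rewrite -ler_pdivrMr// /C (bigD1 (Ordinal nn0))//=.
    have : 0 <= \sum_(i < n0 | i != Ordinal nn0) c i / r ^+ i.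
      by apply: sumr_ge0 => k _; rewrite divr_ge0// ltW.
    lra.
  by apply: le_trans (cr n n0n) _; rewrite ler_peMl ?(ltW (rn n))// /C lerDl.
rewrite -nneseries_esumT; last by move=> n; rewrite lee_fin.
apply: (@le_lt_trans _ _ (C * (1 - r)^-1)%:E); last exact: ltry.
apply: lime_le; first by apply: is_cvg_nneseries => n _ _; rewrite lee_fin.
apply: nearW => n; rewrite sumEFin lee_fin.
apply: le_trans (_ : series (geometric C r) n <= _); last first.
  by apply: geometric_le_lim => //; [rewrite /C addr_ge0|rewrite gtr0_norm].
by apply: ler_sum => k _; exact: cC.
Qed.

Lemma esum_restrict (R : realType) (I : choiceType) (S S' : set I) (F : I -> \bar R) :
  S `<=` S' -> (forall i, S' i -> ~ S i -> F i = 0%E) ->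
  \esum_(i in S') F i = \esum_(i in S) F i.
Proof.
move=> SS' F0; rewrite esum_mkcond [RHS]esum_mkcond; apply: eq_esum => i _.
have [iS'|iS'] := boolP (i \in S'); have [iS|iS] := boolP (i \in S) => //.
  by apply: F0; [exact/set_mem|move=> /mem_set; exact/negP].
by move: iS' => /negP[]; apply/mem_set/SS'/set_mem.
Qed.

Definition words_below (M n : nat) : seq (seq nat) :=
  [seq [seq val i | i <- tval v] | v <- enum {: n.-tuple 'I_M}].

Lemma words_below_uniq M n : uniq (words_below M n).
Proof.
rewrite map_inj_uniq ?enum_uniq// => u v.
by move=> /(inj_map val_inj)/val_inj.
Qed.

Lemma mem_words_below M n u :
  (u \in words_below M n) = (size u == n) && all (fun i => i < M)%N u.
Proof.
apply/mapP/andP => [[v _ ->]|[/eqP su /allP uM]].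
  rewrite size_map size_tuple; split => //; apply/allP => i /mapP[j _ ->].
  exact: ltn_ord.
case: M uM => [|M] uM.
  case: u su uM => [<- _|i u _ /(_ i)]; last by rewrite inE eqxx => /(_ isT).
  by exists [tuple]; rewrite ?mem_enum.
have sv : size [seq (inord i : 'I_M.+1) | i <- u] == n by rewrite size_map su.
exists (Tuple sv); first by rewrite mem_enum.
rewrite /= -map_comp -[LHS]map_id; apply/eq_in_map => i /uM iM /=.
by rewrite inordK.
Qed.

Section PartitionSums.
Context (R : realType) (d : measure_display) (T : measurableType d).
Context (P : probability T R) (X : shift_data T).
Local Notation theta := (base_map X).
Context (phi : T * (nat -> nat) -> R).
Context (kappa : T -> nat) (a : nat) (s : T -> nat -> nat) (Reg : set T).
Hypothesis reg : regular_set X phi kappa a s Reg.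
Context (G : groupType) (psi : (nat -> nat) -> G).

Local Notation loop_term := (loop_term X phi a s).

Lemma loop_words_below w u M : loop X a w u ->
  (forall i, (i < size u)%N -> (nletters X (iter i theta w) <= M)%N) ->
  u \in words_below M (size u).
Proof.
move=> lu lM; rewrite mem_words_below eqxx /=; apply/(all_nthP 0%N) => i iu.
exact: leq_trans (loop_letters lu iu) (lM i iu).
Qed.

Lemma letters_bounded w n : exists M, forall i, (i < n)%N ->
  (nletters X (iter i theta w) <= M)%N.
Proof.
exists (\max_(i < n) nletters X (iter i theta w)) => i ni.
exact: (leq_bigmax (F := fun i : 'I_n => nletters X (iter i theta w)) (Ordinal ni)).
Qed.

Lemma loop_terms_fin t n w :
  (\esum_(u in [set u | size u = n]) (loop_term t u w)%:E < +oo)%E.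
Proof.
have [M lM] := letters_bounded w n.
rewrite (esum_restrict (S := [set` words_below M n])).
- rewrite esum_seq ?words_below_uniq//; last by move=> u; rewrite lee_fin loop_term_ge0.
  by rewrite sumEFin ltry.
- by move=> u /=; rewrite mem_words_below => /andP[/eqP].
- move=> u /= su nu; rewrite /loop_term; case: asboolP => // lu; exfalso; apply: nu.
  by rewrite -su; apply: loop_words_below lu _; rewrite su.
Qed.

Lemma loop_terms_partition_sum t n w : Reg w ->
  (\esum_(u in [set u | size u = n /\ cocycle_word psi u = 1%g]) (loop_term t u w)%:E <=
   (expR (- (t * n%:R)))%:E * partition_sum X psi phi n a w)%E.
Proof.
move=> Rw; rewrite /partition_sum -esumZl ?expR_ge0//; last by move=> u; exact: expeR_ge0.
rewrite (esum_restrict (S := words_from_to X n a a w `&` [set u | cocycle_word psi u = 1%g])).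
- apply: le_esum => u [lu cu]; have su : size u = n by case: lu => -[].
  rewrite -su in lu *; rewrite loop_termE// EFinM lee_wpmul2l ?lee_fin ?expR_ge0//.
  exact: (word_weight_le reg).
- by move=> u [lu cu]; split => //; case: lu => -[].
- move=> u [su cu] nu; rewrite /loop_term; case: asboolP => // lu; exfalso; apply: nu.
  by split => //; rewrite -su.
Qed.

(** Above the exponential growth rate of the partition sums, the Green function
    at the identity converges. *)
Lemma green1_fin t t' n0 w : Reg w -> t' < t ->
  (forall n, (n0 <= n)%N -> (partition_sum X psi phi n a w <= (expR (t' * n%:R))%:E)%E) ->
  (green X phi a s psi t 1%g w < +oo)%E.
Proof.
move=> Rw tt' Zn; rewrite /green.
pose J n := [set u | size u = n /\ cocycle_word psi u = 1%g].
have -> : [set u | cocycle_word psi u = 1%g] = \bigcup_(n in [set: nat]) J n.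
  by apply/seteqP; split=> [u cu|u [n _ []]//]; exists (size u).
rewrite esum_bigcupT; last 2 first.
- by move=> i j _ _ [u [[ui _] [uj _]]]; rewrite -ui -uj.
- by move=> u; rewrite lee_fin loop_term_ge0.
pose c n := fine (\esum_(u in J n) (loop_term t u w)%:E)%E.
have J0 n : (0 <= \esum_(u in J n) (loop_term t u w)%:E)%E.
  by apply: esum_ge0 => u _; rewrite lee_fin loop_term_ge0.
have cE n : (c n)%:E = (\esum_(u in J n) (loop_term t u w)%:E)%E.
  rewrite /c fineK// ge0_fin_numE//; apply: le_lt_trans (loop_terms_fin t n w).
  by apply: esum_subset => u [].
rewrite (eq_esum (b := fun n => (c n)%:E)); last by move=> n _; rewrite cE.
apply: (@esum_geometric _ _ (expR (t' - t)) n0).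
- exact: expR_gt0.
- by rewrite expR_lt1 subr_lt0.
- by move=> n; rewrite -lee_fin cE.
move=> n n0n; rewrite -lee_fin cE; apply: le_trans (loop_terms_partition_sum t n Rw) _.
apply: le_trans (lee_wpmul2l _ (Zn n n0n)) _; first by rewrite lee_fin expR_ge0.
rewrite -EFinM lee_fin -expRD -expRM_natl ler_expR.
by rewrite le_eqVlt; apply/orP; left; apply/eqP; ring.
Qed.

(** The bound [M] makes the sums over these words finite sums of functions that
    are measurable in the environment. *)
Definition commutator_words (M n : nat) : seq (seq nat) :=
  [seq u <- words_below M n | `[< commutator_subgroup (cocycle_word psi u) >]].

Lemma mem_commutator_words M n u : u \in commutator_words M n ->
  size u = n /\ commutator_subgroup (cocycle_word psi u).
Proof. by rewrite mem_filter mem_words_below => /andP[/asboolP ? /andP[/eqP]]. Qed.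

Lemma commutator_words_uniq M n : uniq (commutator_words M n).
Proof. by rewrite filter_uniq// words_below_uniq. Qed.

Lemma partition_sum_ab_le M n w : Reg w ->
  (forall i, (i < n)%N -> (nletters X (iter i theta w) <= M)%N) ->
  (partition_sum X (fun x => ab_proj (psi x)) phi n a w <=
   (expR (distortion R X kappa n w) *
     \sum_(u <- commutator_words M n) loop_term 0 u w)%:E)%E.
Proof.
move=> Rw lM; rewrite EFinM -sumEFin -esum_seq ?commutator_words_uniq//; last first.
  by move=> u; rewrite lee_fin loop_term_ge0.
rewrite -esumZl ?expR_ge0//; last by move=> u; rewrite lee_fin loop_term_ge0.
rewrite /partition_sum.
apply: (@le_trans _ _ (\esum_(u in words_from_to X n a a w `&`
    [set u | cocycle_word (fun x => ab_proj (psi x)) u = 1%g])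
    ((expR (distortion R X kappa n w))%:E * (loop_term 0 u w)%:E)%E)).
  apply: le_esum => u [lu _]; have su : size u = n by case: lu => -[].
  rewrite -su in lu *; rewrite loop_termE// mul0r oppr0 expR0 mul1r.
  rewrite -[leRHS]lneK; last by rewrite in_itv/= leey andbT -EFinM lee_fin mulr_ge0 ?expR_ge0.
  rewrite lee_expeR; apply: ge_ereal_sup => _ [y yu <-].
  rewrite -lee_expeR lneK; last by rewrite in_itv/= leey andbT -EFinM lee_fin mulr_ge0 ?expR_ge0.
  by rewrite -EFinM /= lee_fin; apply: (birkhoff_word_weight reg).
apply: esum_subset => u [lu /cocycle_word_ab1 cu] /=.
have su : size u = n by case: lu => -[].
rewrite mem_filter; apply/andP; split; first exact/asboolP.
by rewrite -su; apply: (@loop_words_below w); [rewrite /loop su|rewrite su].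
Qed.

End PartitionSums.

(** * The growth inequality *)

(** Averages the tangent line inequality of the exponential at [l]; truncating
    at [K] costs [expR (l - K)]. *)
Lemma weighted_min_ge (R : realType) (I : Type) (V : seq I) (p y : I -> R) (K l : R) :
  (forall i, 0 <= p i) -> \sum_(i <- V) p i = 1 ->
  \sum_(i <- V) p i * expR (- y i) <= expR (- l) ->
  l - expR (l - K) <= \sum_(i <- V) p i * Num.min (y i) K.
Proof.
move=> p0 p1 le_l.
have tangent (v : R) : 1 + l - expR l * expR (- v) <= v.
  by have := expR_ge1Dx (l - v); rewrite -expRD; lra.
have minE i : expR (- Num.min (y i) K) <= expR (- y i) + expR (- K).
  have := expR_ge0 (- y i); have := expR_ge0 (- K); rewrite minEle; case: ifP => _; lra.
apply: (@le_trans _ _ (\sum_(i <- V) p i * (1 + l - expR l * (expR (- y i) + expR (- K))))).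
  have -> : \sum_(i <- V) p i * (1 + l - expR l * (expR (- y i) + expR (- K))) =
      (1 + l) * (\sum_(i <- V) p i) - expR l * (\sum_(i <- V) p i * expR (- y i)) -
      expR l * expR (- K) * (\sum_(i <- V) p i).
    by rewrite !mulr_sumr -!sumrB; apply: eq_bigr => i _; ring.
  rewrite p1 -expRD; have := ler_wpM2l (expR_ge0 l) le_l; rewrite -expRD subrr expR0; lra.
apply: ler_sum => i _; apply: ler_wpM2l => //; apply: le_trans (tangent _).
by have := ler_wpM2l (expR_ge0 l) (minE i); lra.
Qed.

Lemma harnack_arith (R : realType) (dd tn ttn s1 s2 al be : R) : dd <= s2 -> tn <= ttn ->
  - dd + (- tn - s1) + al <= be -> 0 <= ttn + s1 + s2 - al + be.
Proof. lra. Qed.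

Lemma neg_defectE (R : realType) (c x y : R) : - (c - x + y) = (- c - y) + x.
Proof. ring. Qed.

Lemma balance_arith (R : realType) (p k d1 d2 c e : R) : d1 <= d2 -> d2 <= k ->
  p - 2 * d1 + c <= c + e -> p <= 2 * k + e.
Proof. lra. Qed.

Section Growth.
Context (R : realType) (d : measure_display) (T : measurableType d).
Context (P : probability T R) (X : shift_data T).
Hypothesis shift : random_shift_of_finite_type P X.
Local Notation theta := (base_map X).
Context (phi : T * (nat -> nat) -> R).
Hypothesis mphi : measurable_fun (total_space X : set (T * sequences)) phi.
Hypothesis iphi : P.-integrable [set: T] (fiber_sup_norm X phi).
Context (kappa : T -> nat).
Hypothesis mkappa : measurable_fun [set: T] kappa.
Hypothesis ikappa : (\int[P]_w ((kappa w)%:R)%:E < +oo)%E.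
Context (a : nat) (s : T -> nat -> nat) (Reg : set T).
Hypothesis reg : regular_set X phi kappa a s Reg.
Hypothesis mReg : measurable Reg.
Hypothesis ms : forall i j, measurable [set w | s w i = j].
Context (G : groupType) (psi : (nat -> nat) -> G).
Hypothesis psi0 : depends_on_first_coordinate psi.
Context (m : (G -> R) -> R).
Hypothesis m_mean : invariant_mean m.
Context (N : G -> nat).
Hypothesis mixing : forall x n w, Reg w -> (N x <= n)%N ->
  exists u, [/\ loop X a w u, size u = n & cocycle_word psi u = x].
Context (t : R).
Hypothesis green_fin : forall g w, Reg w -> (green X phi a s psi t g w < +oo)%E.

Local Notation green := (green X phi a s psi t).
Local Notation loop_term := (loop_term X phi a s).
Local Notation dist := (distortion R X kappa).

Definition log_green (g : G) (w : T) : R :=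
  if `[< Reg w >] then ln (fine (green g w)) else 0.

Definition step_cost (w : T) : R :=
  if `[< Reg w >] then `|t| + sup_norm X phi w + (kappa w)%:R else 0.

Let mbReg : measurable_fun [set: T] (fun w => `[< Reg w >]).
Proof.
apply: (measurable_fun_bool true); rewrite setTI.
by rewrite (_ : _ @^-1` _ = Reg)//; apply/seteqP; split=> w /= => /asboolP.
Qed.

Let mkappaR : measurable_fun [set: T] (fun w => (kappa w)%:R : R).
Proof. by apply: (measurableT_comp (f := fun n : nat => n%:R : R)). Qed.

Lemma measurable_log_green g : measurable_fun [set: T] (log_green g).
Proof.
apply: measurable_fun_ifT => //; apply: measurableT_comp => //.
apply: measurableT_comp => //. exact: (measurable_green shift mphi a ms).
Qed.

Let ikappaR : P.-integrable [set: T] (EFin \o (fun w => (kappa w)%:R : R)).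
Proof.
apply/integrableP; split; first exact/measurable_EFinP.
by under eq_integral do rewrite /= ger0_norm//.
Qed.

Let isup : P.-integrable [set: T] (EFin \o sup_norm X phi).
Proof.
apply/integrableP; split.
  by apply/measurable_EFinP; apply: measurableT_comp => //; case/integrableP: iphi.
case/integrableP: iphi => mf; apply: le_lt_trans; apply: ge0_le_integral => //.
- by apply: measurableT_comp => //; apply/measurable_EFinP; exact: measurableT_comp.
- exact: measurableT_comp.
- move=> w _; rewrite /sup_norm /comp; case: (fiber_sup_norm X phi w) => [r| |]//=.
  + by rewrite normr0 leey.
  + by rewrite normr0 leey.
Qed.

Lemma step_cost_integrable : P.-integrable [set: T] (EFin \o step_cost).
Proof.
have I : P.-integrable [set: T]
    (EFin \o (fun w => `|t| + sup_norm X phi w + (kappa w)%:R)).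
  pose c : T -> R := fun=> `|t|; pose k : T -> R := fun w => (kappa w)%:R.
  rewrite (_ : EFin \o _ = ((EFin \o c) \+ (EFin \o sup_norm X phi)) \+ (EFin \o k))%E//.
  apply: integrableD => //; apply: integrableD => //.
  exact/bounded_meas_integrable/bounded_meas_cst.
apply: (le_integrable measurableT _ _ I).
  apply/measurable_EFinP; apply: measurable_fun_ifT => //.
  by apply/measurable_EFinP; case/integrableP: I.
move=> w _ /=; rewrite lee_fin /step_cost; case: ifP => _ //.
by rewrite normr0.
Qed.

Lemma step_cost_ge0 w : 0 <= step_cost w.
Proof.
rewrite /step_cost; case: asboolP => // Rw.
by rewrite !addr_ge0// (sup_norm_ge0 reg).
Qed.

Local Notation cost := (orbit_sum theta step_cost).

Lemma cost_regular n w : Reg w -> cost n w = `|t| * n%:R +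
  \sum_(i < n) sup_norm X phi (iter i theta w) + \sum_(i < n) (kappa (iter i theta w))%:R.
Proof.
move=> Rw; rewrite /orbit_sum mulr_natr -[X in _ *+ X](card_ord n) -sumr_const.
rewrite -!big_split /=; apply: eq_bigr => i _.
by rewrite /step_cost asboolT//; apply/(regular_iter reg).
Qed.

Lemma distortion_le n w : dist n w <= \sum_(i < n) (kappa (iter i theta w))%:R.
Proof.
apply: ler_sum => i _; rewrite ler_piMr// invf_le1 ?exprn_gt0//.
by rewrite exprn_ege1// ler1n.
Qed.

Lemma distortion_ge0 n w : 0 <= dist n w.
Proof. by apply: sumr_ge0 => i _; rewrite divr_ge0// exprn_ge0. Qed.

Lemma green_gt0 g w : Reg w -> (0 < green g w)%E.
Proof.
move=> Rw; have [u [lu _ <-]] := mixing Rw (leqnn (N g)).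
apply: lt_le_trans (green_ge_term _ _ _ _ _ _ _ _); rewrite lte_fin loop_termE//.
by rewrite mulr_gt0// expR_gt0.
Qed.

Lemma green_EFin g w : Reg w -> green g w = (expR (log_green g w))%:E.
Proof.
move=> Rw; have g0 := green_gt0 g Rw.
have gf : green g w \is a fin_num by rewrite ge0_fin_numE ?green_fin// ltW.
by rewrite /log_green asboolT// lnK ?fineK// posrE -lte_fin fineK.
Qed.

(** Harnack inequality: prefixing the loop [u] to loops with product [x^-1 * g],
    where [x] is the product of [u], yields loops with product [g]. *)
Lemma loop_defect_ge0 w u g : Reg w -> loop X a w u ->
  0 <= defect theta log_green step_cost (size u) (cocycle_word psi u) g w.
Proof.
move=> Rw lu; have Ru : Reg (iter (size u) theta w) by apply/(regular_iter reg).
have := green_step reg psi0 t g Rw lu.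
rewrite !green_EFin// -EFinM lee_fin loop_termE// /defect cost_regular//.
have := word_weight_ge reg Rw lu; set S1 := \sum_(i < _) sup_norm _ _ _ => W.
have D := distortion_le (size u) w; move: D; set S2 := \sum_(i < _) _ => D.
set A := log_green _ _; set B := log_green g w => H.
have H' : expR (- dist (size u) w) * (expR (- (t * (size u)%:R)) * expR (- S1)) *
    expR A <= expR B.
  apply: le_trans H; rewrite ler_wpM2r ?expR_ge0//.
  by rewrite ler_wpM2l ?expR_ge0// ler_wpM2l ?expR_ge0.
move: H'; rewrite -!expRD ler_expR.
apply: (harnack_arith D); by rewrite ler_wpM2r// ler_norm.
Qed.

Lemma defect_ge0 n x g w : (N x <= n)%N -> 0 <= defect theta log_green step_cost n x g w.
Proof.
move=> xn; have [Rw|nRw] := pselect (Reg w).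
  by have [u [lu <- <-]] := mixing Rw xn; exact: loop_defect_ge0.
have nRi i : ~ Reg (iter i theta w) by move/(regular_iter reg).
rewrite /defect /log_green !asboolF// /orbit_sum subr0 addr0; apply: sumr_ge0 => i _.
exact: step_cost_ge0.
Qed.

Let distortion_integrable n : P.-integrable [set: T] (EFin \o dist n) /\
  \int[P]_w dist n w <= \int[P]_w (kappa w)%:R.
Proof.
have Pt := base_preserving shift.
have ii i : P.-integrable [set: T] (EFin \o (fun w => (kappa (iter i theta w))%:R : R)).
  exact: (preserving_integrable (preserving_iter i Pt) ikappaR).
pose k0 := \int[P]_w (kappa w)%:R : R.
have k00 : 0 <= k0 by exact: Rintegral_ge0.
suff H (F : nat -> R) k : (forall i, 0 <= F i) ->
    P.-integrable [set: T] (EFin \o (fun w => \sum_(i < k) (kappa (iter i theta w))%:R * F i)) /\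
    \int[P]_w (\sum_(i < k) (kappa (iter i theta w))%:R * F i) = k0 * \sum_(i < k) F i.
  have [|I E] := H (fun i => 2 ^- (n - i)) n; first by move=> i; rewrite invr_ge0 exprn_ge0.
  split => //; rewrite /distortion E ler_piMr//.
  suff -> : \sum_(i < n) (2 ^- (n - i) : R) = 1 - 2 ^- n by rewrite gerBl invr_ge0 exprn_ge0.
  elim: n {I E} => [|n IH]; first by rewrite big_ord0 expr0 invr1 subrr.
  rewrite big_ord_recl subn0 /=.
  under eq_bigr do rewrite /bump /= add1n subSS.
  rewrite IH exprS invfM; move: (2 ^+ n)^-1 => z; lra.
move=> F0; elim: k => [|k [Ik Ek]].
  rewrite (_ : (fun w => _) = fun=> 0); last by apply/funext => w; rewrite big_ord0.
  by rewrite Rintegral_cstT big_ord0 mulr0; split => //; exact/bounded_meas_integrable/bounded_meas_cst.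
have IF : P.-integrable [set: T] (EFin \o (fun w => (kappa (iter k theta w))%:R * F k)).
  rewrite (_ : EFin \o _ = (fun w => (F k)%:E * (EFin \o (fun w => (kappa (iter k theta w))%:R)) w)%E).
    exact: integrableZl.
  by apply/funext => w; rewrite /= -EFinM mulrC.
pose h1 w : R := \sum_(i < k) (kappa (iter i theta w))%:R * F i.
pose h2 w : R := (kappa (iter k theta w))%:R * F k.
have -> : (fun w => \sum_(i < k.+1) (kappa (iter i theta w))%:R * F i) =
    (fun w => h1 w + h2 w).
  by apply/funext => w; rewrite big_ord_recr.
split.
  rewrite (_ : EFin \o _ = ((EFin \o h1) \+ (EFin \o h2))%E)//.
  exact: integrableD.
rewrite RintegralD// Ek big_ord_recr mulrDr; congr (_ + _) => /=; rewrite /h2.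
under eq_Rintegral do rewrite mulrC.
rewrite RintegralZl// mulrC; congr (_ * _).
exact: (preserving_Rint (preserving_iter k Pt) ikappaR).
Qed.

(** Average the defects at the products of these words, with their normalized
    weights restricted to [E]. The result is at most the integral of [cost n] by
    [commutator_defect_le], and at least the integral over [E] of
    [(t' - t) n - 2 dist n + cost n] by convexity. *)
Lemma growth_bound (n M L : nat) (t' : R) (E : set T) : (N 1%g <= n)%N ->
  measurable E -> E `<=` Reg -> t <= t' ->
  (forall w, E w -> cost n w <= L%:R) ->
  (forall w, E w -> expR (t' * n%:R - dist n w) <=
     \sum_(u <- commutator_words psi M n) loop_term 0 u w) ->
  (t' - t) * n%:R * fine (P E) <=
    2 * \int[P]_w (kappa w)%:R + \int[P]_(w in ~` E) cost n w.
Proof.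
move=> n1 mE ER tt' costL Zge.
pose V := commutator_words psi M n.
pose Z w := \sum_(u <- V) loop_term 0 u w.
pose av (u : seq nat) w :=
  if u \in V then \1_E w * (loop_term 0 u w * expR (- ln (Z w))) else 0.
pose x (u : seq nat) : G := if u \in V then cocycle_word psi u else 1%g.
pose l w := (t' - t) * n%:R - 2 * dist n w + cost n w.
(* [l] is the lower bound for the averaged defects over [E], and [M'] an upper
   bound for [l]; the normalization [1 / Z] is written with the exponential so
   that its measurability is immediate. *)
pose M' := (t' - t) * n%:R + L%:R.
have lt0 u w : 0 <= loop_term 0 u w by exact: loop_term_ge0.
have Zgt0 w : E w -> 0 < Z w by move=> Ew; exact: lt_le_trans (expR_gt0 _) (Zge w Ew).
have ZV w : E w -> expR (- ln (Z w)) = (Z w)^-1.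
  by move=> Ew; rewrite expRN lnK// posrE Zgt0.
have E1 w : E w -> \1_E w = 1 :> R by move=> Ew; rewrite indicE mem_set.
have E0 w : ~ E w -> \1_E w = 0 :> R by move=> nE; rewrite indicE memNset.
have av_ge0 u w : 0 <= av u w.
  by rewrite /av; case: ifP => // _; rewrite !mulr_ge0// ?expR_ge0// indic_ge0.
have av_sum w : E w -> \sum_(u <- V) av u w = 1.
  move=> Ew; rewrite -(divff (lt0r_neq0 (Zgt0 w Ew))) mulr_suml big_seq [RHS]big_seq.
  by apply: eq_bigr => u uV; rewrite /av uV E1// mul1r ZV.
have av_out u w : ~ E w -> av u w = 0.
  by move=> nE; rewrite /av; case: ifP => // _; rewrite E0// mul0r.
have av_le1 u w : av u w <= 1.
  have [Ew|nE] := pselect (E w); last by rewrite av_out.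
  rewrite /av; case: ifP => // uV; rewrite E1// mul1r ZV// ler_pdivrMr ?Zgt0// mul1r.
  by rewrite /Z (big_rem u)//= lerDl sumr_ge0.
have mZ : measurable_fun [set: T] Z.
  by apply: measurable_sum => u; exact: (measurable_loop_term shift mphi a ms).
have av_weight u : weight (av u).
  split; last exact: av_ge0.
  split; last by exists 1 => w; rewrite ger0_norm.
  rewrite /av; case: (u \in V) => //; apply: measurable_funM.
    exact: measurable_indic.
  apply: measurable_funM; first exact: (measurable_loop_term shift mphi a ms).
  apply: measurableT_comp => //; apply: measurableT_comp => //.
  exact: measurableT_comp.
have xC u : commutator_subgroup (x u).
  rewrite /x; case: ifP => [/mem_commutator_words[]//|_].
  by case: (commutator_subgroupP G).
have posx u g w : av u w != 0 -> 0 <= defect theta log_green step_cost n (x u) g w.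
  rewrite /av /x; case: ifP => [uV|_]; last by rewrite eqxx.
  have [su _] := mem_commutator_words uV.
  have [Ew|nE] := pselect (E w); last by rewrite E0// mul0r eqxx.
  have [lu _|nl] := pselect (loop X a w u).
    by rewrite -su; apply: loop_defect_ge0 => //; exact: ER.
  by rewrite /loop_term asboolF// mul0r mulr0 eqxx.
(* Superharmonicity of the Green function, normalized by [Z]. *)
have super g w : E w -> \sum_(u <- V) av u w *
    expR (- defect theta log_green step_cost n (x u) g w) <= expR (- l w).
  move=> Ew; have Rw := ER w Ew.
  have Rn : Reg (iter n theta w) by apply/(regular_iter reg).
  have sV u : u \in V -> size u = n by move=> /mem_commutator_words[].
  have := green_superharmonic reg psi0 t g Rw (commutator_words_uniq psi M n) sV.
  rewrite green_EFin//.
  under eq_bigr do rewrite green_EFin// -EFinM.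
  rewrite sumEFin -EFinM lee_fin => H.
  have {}H : expR (- dist n w - t * n%:R) * (\sum_(u <- V) loop_term 0 u w *
      expR (log_green ((cocycle_word psi u)^-1 * g)%g (iter n theta w))) <=
      expR (log_green g w).
    apply: le_trans H; rewrite expRD -mulrA ler_wpM2l ?expR_ge0// mulr_sumr.
    rewrite big_seq [leRHS]big_seq; apply: ler_sum => u uV.
    rewrite mulrA ler_wpM2r ?expR_ge0// /loop_term; case: ifP => _; last by rewrite mulr0.
    by rewrite (sV u uV) mul0r oppr0 expR0 mul1r.
  set S := \sum_(u <- V) loop_term 0 u w * _ in H.
  have -> : \sum_(u <- V) av u w * expR (- defect theta log_green step_cost n (x u) g w) =
      (Z w)^-1 * (expR (- cost n w - log_green g w) * S).
    rewrite /S !mulr_sumr big_seq [RHS]big_seq; apply: eq_bigr => u uV.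
    rewrite /av /x uV E1// mul1r ZV// /defect.
    rewrite neg_defectE.
    by rewrite expRD; ring.
  have S_le : S <= expR (log_green g w + dist n w + t * n%:R).
    have := ler_wpM2l (expR_ge0 (dist n w + t * n%:R)) H.
    rewrite mulrA -!expRD (_ : _ + _ = 0); last by ring.
    rewrite expR0 mul1r => /le_trans; apply; rewrite ler_expR.
    by rewrite le_eqVlt; apply/orP; left; apply/eqP; ring.
  have Zinv : (Z w)^-1 <= expR (- (t' * n%:R - dist n w)).
    by rewrite expRN lef_pV2 ?posrE ?expR_gt0 ?Zgt0//; exact: Zge.
  have S0 : 0 <= S by apply: sumr_ge0 => u _; exact: mulr_ge0 (lt0 u w) (expR_ge0 _).
  apply: (@le_trans _ _ (expR (- (t' * n%:R - dist n w)) *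
     (expR (- cost n w - log_green g w) * expR (log_green g w + dist n w + t * n%:R)))).
    apply: ler_pM; [|exact: mulr_ge0 (expR_ge0 _) S0|exact: Zinv|].
      by rewrite invr_ge0; exact: ltW (Zgt0 w Ew).
    exact: (ler_wpM2l (expR_ge0 _) S_le).
  rewrite -!expRD ler_expR /l le_eqVlt; apply/orP; left; apply/eqP; ring.
have Pt := base_preserving shift.
have icost := orbit_sum_integrable Pt step_cost_integrable n.
have [idist dist_le] := distortion_integrable n.
have mcost : measurable_fun [set: T] (cost n) by case/integrableP: icost => /measurable_EFinP.
have mdist : measurable_fun [set: T] (dist n) by case/integrableP: idist => /measurable_EFinP.
have dist_cost w : Reg w -> dist n w <= cost n w.
  move=> Rw; rewrite cost_regular//; apply: le_trans (distortion_le n w) _.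
  rewrite lerDr addr_ge0// ?mulr_ge0//; apply: sumr_ge0 => i _.
  by apply: (sup_norm_ge0 reg); apply/(regular_iter reg).
have b1 : bounded_meas (\1_E : T -> R) by exact: bounded_meas_indic.
have bcost : bounded_meas (fun w => \1_E w * cost n w).
  split; first by apply: measurable_funM => //; exact: measurable_indic.
  exists L%:R => w; have [Ew|nE] := pselect (E w); last by rewrite E0// mul0r normr0.
  rewrite E1// mul1r ger0_norm ?costL//; apply: sumr_ge0 => i _; exact: step_cost_ge0.
have bdist : bounded_meas (fun w => \1_E w * dist n w).
  split; first by apply: measurable_funM => //; exact: measurable_indic.
  exists L%:R => w; have [Ew|nE] := pselect (E w); last by rewrite E0// mul0r normr0.
  rewrite E1// mul1r ger0_norm ?distortion_ge0//.
  by apply: le_trans (costL w Ew); exact/dist_cost/ER.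
have bl : bounded_meas (fun w => \1_E w * l w).
  have -> : (fun w => \1_E w * l w) = (fun w => (t' - t) * n%:R * \1_E w +
      (-2 * (\1_E w * dist n w)) + \1_E w * cost n w).
    by apply/funext => w; rewrite /l; ring.
  apply: bounded_measD => //; apply: bounded_measD; apply: bounded_measM => //; exact: bounded_meas_cst.
(* The truncation at [K] is removed below by letting [K] go to infinity. *)
have key (K : nat) : \int[P]_w (\1_E w * l w) - expR (M' - K%:R) <= \int[P]_w cost n w.
  have [hi [Phi hK hiK]] := base_inverse shift.
  apply: (commutator_defect_le m_mean Pt Phi hK measurable_log_green
    step_cost_integrable step_cost_ge0 defect_ge0 (s := V) (a := av) (x := x)
    (K := K) n1 av_weight xC _ posx) => [w|g].
    have [Ew|nE] := pselect (E w); first by rewrite av_sum.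
    by rewrite big1 ?ler01// => u _; rewrite av_out.
  rewrite -(Rintegral_cstT P (expR (M' - K%:R))) -RintegralB//; last 2 first.
  - exact: (bounded_meas_integrable P bl).
  - by apply: bounded_meas_integrable; exact: bounded_meas_cst.
  apply: le_Rint.
  - apply: bounded_meas_integrable; apply: (bounded_measD bl); exact: bounded_meas_cst.
  - apply: bounded_meas_integrable; apply: bounded_meas_sum => u.
    apply: (@bounded_family_bounded_meas _ _ _ _ (truncation (av u)
      (defect theta log_green step_cost n (x u)) K%:R) g).
    apply: (truncation_bounded (av_weight u) _ (ler0n R K)); split=> [g'|g' w aw].
      exact: (measurable_defect Pt measurable_log_green step_cost_integrable).
    exact: (posx u g' w aw).
  move=> w; have [Ew|nE] := pselect (E w); last first.
    rewrite E0// mul0r sub0r; apply: (@le_trans _ _ 0); first by rewrite oppr_le0 expR_ge0.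
    by rewrite big1// => u _; rewrite av_out// mul0r.
  rewrite E1// mul1r.
  apply: le_trans (weighted_min_ge K%:R _ (av_sum w Ew) (super g w Ew)) => //.
  rewrite lerB// ler_expR lerB// /l /M' -addrA lerD// -[leRHS]add0r lerD ?costL//.
  by rewrite oppr_le0 mulr_ge0// distortion_ge0.
have E1int : \int[P]_w \1_E w = fine (P E).
  by rewrite /Rintegral integral_indic// setIT.
have El : \int[P]_w (\1_E w * l w) = (t' - t) * n%:R * fine (P E) -
    2 * \int[P]_w (\1_E w * dist n w) + \int[P]_w (\1_E w * cost n w).
  have Z1 : bounded_meas (fun w => (t' - t) * n%:R * \1_E w) by apply: bounded_measM => //; exact: bounded_meas_cst.
  have Z2 : bounded_meas (fun w => -2 * (\1_E w * dist n w)) by apply: bounded_measM => //; exact: bounded_meas_cst.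
  transitivity (\int[P]_w ((t' - t) * n%:R * \1_E w +
      (-2 * (\1_E w * dist n w)) + \1_E w * cost n w)).
    by congr (Rintegral _ _ _); apply/funext => w; rewrite /l; ring.
  rewrite RintegralD//; [|exact: bounded_meas_integrable (bounded_measD Z1 Z2)|exact: bounded_meas_integrable].
  rewrite RintegralD//; [|exact: bounded_meas_integrable..].
  rewrite RintegralZl//; [|exact: bounded_meas_integrable].
  rewrite RintegralZl//; [|exact: bounded_meas_integrable].
  by rewrite E1int mulNr.
have Ecost : \int[P]_w cost n w = \int[P]_w (\1_E w * cost n w) + \int[P]_(w in ~` E) cost n w.
  rewrite -{1}(setUv E) Rintegral_setU//.
  - by rewrite [in LHS]Rintegral_mkcond patch_indic; congr (_ + _);
      congr (Rintegral _ _ _); apply/funext => w /=; rewrite mulrC.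
  - exact: measurableC.
  - by rewrite setUv.
  - by rewrite disj_set2E setICr.
have dist_le' : \int[P]_w (\1_E w * dist n w) <= \int[P]_w dist n w.
  apply: le_Rint => //; first exact: bounded_meas_integrable.
  move=> w; have [Ew|nE] := pselect (E w); first by rewrite E1// mul1r.
  by rewrite E0// mul0r distortion_ge0.
have lim : \int[P]_w (\1_E w * l w) <= \int[P]_w cost n w.
  rewrite leNgt; apply/negP => lt; rewrite -subr_gt0 in lt; set e := _ - _ in lt.
  have [K HK] : exists K : nat, M' - ln e < K%:R.
    exists (Num.bound `|M' - ln e|); apply: le_lt_trans (ler_norm _) _.
    exact: archi_boundP.
  have := key K; rewrite lerBlDr addrC -lerBlDr -/e leNgt => /negP; apply.
  by rewrite -[ltRHS](lnK (x := e)) ?posrE// ltr_expR ltrBlDr addrC -ltrBlDr.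
by move: lim; rewrite El Ecost; exact: balance_arith dist_le' dist_le.
Qed.

End Growth.

(** * No gap between the growth rates *)

Section SmallSets.
Context (R : realType) (d : measure_display) (T : measurableType d).
Context (P : probability T R).

Lemma exists_measure_gt (F : nat -> set T) (c : \bar R) :
  (forall n, measurable (F n)) -> {homo F : n k / (n <= k)%N >-> (n <= k)%O} ->
  (c < P (\bigcup_n F n))%E -> exists n, (c < P (F n))%E.
Proof.
move=> mF Fmono cF; apply: contrapT => /forallNP nF.
have cv := nondecreasing_cvg_mu mF (bigcupT_measurable _ mF) Fmono (mu := P).
move: cF; rewrite ltNge => /negP; apply; rewrite -(cvg_lim _ cv)//.
apply: lime_le; first by apply/cvg_ex; eexists; exact: cv.
by apply: nearW => n /=; rewrite leNgt; apply/negP/nF.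
Qed.

Context (h hi : T -> T).
Hypotheses (Ph : preserving P h) (Phi : preserving P hi).
Hypotheses (hK : cancel h hi).

(** Absolute continuity of the integral of [beta], applied to the images of [A]
    along the orbit, which have the same measure. *)
Lemma orbit_sum_small (beta : T -> R) (e : R) :
  P.-integrable [set: T] (EFin \o beta) -> (forall w, 0 <= beta w) -> 0 < e ->
  exists2 delta : R, 0 < delta & forall A n, measurable A -> (P A < delta%:E)%E ->
    \int[P]_(w in A) orbit_sum h beta n w <= n%:R * e.
Proof.
move=> ib b0 e0; have [delta [d0 small]] := integral_normr_continuous ib e0.
exists delta => // A n mA PA.
have iterK k : cancel (iter k h) (iter k hi).
  by elim: k => // k IH w; rewrite iterSr /= hK IH.
have ii k := preserving_integrable (preserving_iter k Ph) ib.
have iA f : P.-integrable [set: T] f -> P.-integrable A f.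
  by move=> If; apply: integrableS If.
have one k : \int[P]_(w in A) beta (iter k h w) <= e.
  have mB : measurable (iter k hi @^-1` A).
    by have [mk _] := preserving_iter k Phi; rewrite -[X in measurable X]setTI; exact: mk.
  have PB : (P (iter k hi @^-1` A) < delta%:E)%E.
    by have [_ ->] := preserving_iter k Phi.
  have := small _ mB PB; under eq_Rintegral do rewrite ger0_norm//.
  move/ltW; apply: le_trans; rewrite Rintegral_mkcond [leRHS]Rintegral_mkcond.
  rewrite -(preserving_Rint (f := beta \_ (iter k hi @^-1` A)) (preserving_iter k Ph)).
    rewrite le_eqVlt; apply/orP; left; apply/eqP; apply: eq_Rintegral => w _.
    have memE : (iter k h w \in iter k hi @^-1` A) = (w \in A).
      apply/idP/idP => /set_mem; first by rewrite /= iterK => ?; exact/mem_set.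
      by move=> Aw; apply/mem_set; rewrite /= iterK.
    by rewrite !patchE memE.
  rewrite -restrict_EFin; apply/integrable_restrict => //.
  by rewrite setTI; apply: integrableS ib.
elim: n => [|n IH].
  rewrite mul0r le_eqVlt; apply/orP; left; apply/eqP.
  rewrite -[RHS](mul0r (fine (P A))) -(Rintegral_cst P mA).
  by apply: eq_Rintegral => w _; rewrite /orbit_sum big_ord0.
have -> : \int[P]_(w in A) orbit_sum h beta n.+1 w =
    \int[P]_(w in A) orbit_sum h beta n w + \int[P]_(w in A) beta (iter n h w).
  rewrite -RintegralD//; last 2 first.
  - by apply: iA; exact: orbit_sum_integrable.
  - exact: (iA _ (ii n)).
  by apply: eq_Rintegral => w _; rewrite /orbit_sum big_ord_recr.
by rewrite -natr1 mulrDl mul1r lerD.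
Qed.

End SmallSets.

Section NoGap.
Context (R : realType) (d : measure_display) (T : measurableType d).
Context (P : probability T R) (X : shift_data T).
Hypothesis shift : random_shift_of_finite_type P X.
Local Notation theta := (base_map X).
Context (phi : T * (nat -> nat) -> R).
Hypothesis mphi : measurable_fun (total_space X : set (T * sequences)) phi.
Hypothesis iphi : P.-integrable [set: T] (fiber_sup_norm X phi).
Context (kappa : T -> nat).
Hypothesis mkappa : measurable_fun [set: T] kappa.
Hypothesis ikappa : (\int[P]_w ((kappa w)%:R)%:E < +oo)%E.
Context (a : nat) (s : T -> nat -> nat) (Reg : set T).
Hypothesis reg : regular_set X phi kappa a s Reg.
Hypothesis mReg : measurable Reg.
Hypothesis Reg_full : P (~` Reg) = 0%E.
Hypothesis ms : forall i j, measurable [set w | s w i = j].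
Context (G : groupType) (psi : (nat -> nat) -> G).
Hypothesis psi0 : depends_on_first_coordinate psi.
Context (m : (G -> R) -> R).
Hypothesis m_mean : invariant_mean m.
Context (N : G -> nat).
Hypothesis mixing : forall x n w, Reg w -> (N x <= n)%N ->
  exists u, [/\ loop X a w u, size u = n & cocycle_word psi u = x].
Context (t t' : R).
Hypothesis green_fin : forall g w, Reg w -> (green X phi a s psi t g w < +oo)%E.
Hypothesis growth : forall w, Reg w -> exists n0, forall n, (n0 <= n)%N ->
  ((expR (t' * n%:R))%:E <= partition_sum X (fun x => ab_proj (psi x)) phi n a w)%E.

Local Notation lterm := (loop_term X phi a s).
Local Notation dist := (distortion R X kappa).
Local Notation beta := (step_cost X phi kappa Reg t).
Local Notation cost := (orbit_sum theta beta).

Let E n M : set T := Reg `&` [set w | cost n w <= M%:R] `&`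
  [set w | expR (t' * n%:R - dist n w) <= \sum_(u <- commutator_words psi M n) lterm 0 u w].

Let ibeta := step_cost_integrable iphi mkappa ikappa mReg t.

Let mE n M : measurable (E n M).
Proof.
have mcost : measurable_fun [set: T] (cost n).
  have := orbit_sum_integrable (base_preserving shift) ibeta n.
  by case/integrableP => /measurable_EFinP.
have mdist : measurable_fun [set: T] (dist n).
  apply: measurable_sum => i; apply: measurable_funM => //.
  apply: (measurableT_comp (f := fun w => (kappa w)%:R : R)).
    by apply: (measurableT_comp (f := fun n : nat => n%:R : R)).
  by have [] := preserving_iter i (base_preserving shift).
apply: measurableI.
  apply: measurableI => //.
  have := measurable_fun_ler mcost (measurable_cst (M%:R : R)).
  by move=> /(_ measurableT [set true] I); rewrite setTI.
have mZ : measurable_fun [set: T] (fun w => \sum_(u <- commutator_words psi M n) lterm 0 u w).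
  by apply: measurable_sum => u; exact: (measurable_loop_term shift mphi a ms).
have mX : measurable_fun [set: T] (fun w => expR (t' * n%:R - dist n w)).
  apply: measurableT_comp => //; exact: measurable_funB.
by have := measurable_fun_ler mX mZ measurableT (Y := [set true]) I; rewrite setTI.
Qed.

Let E_mono n : {homo E n : M k / (M <= k)%N >-> (M <= k)%O}.
Proof.
move=> M k Mk; apply/subsetPset => w [[Rw cw] Zw]; split; first split => //.
  by apply: le_trans cw _; rewrite ler_nat.
apply: le_trans Zw _; rewrite -lee_fin -!sumEFin.
rewrite -!esum_seq ?commutator_words_uniq//; try by move=> u; rewrite lee_fin loop_term_ge0.
apply: esum_subset => u /=; rewrite !mem_filter !mem_words_below => /and3P[-> -> /allP uM] /=.
by apply/allP => i /uM iM; exact: leq_trans iM Mk.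
Qed.

Let E_ex w : Reg w -> exists n0, forall n, (n0 <= n)%N -> exists M, E n M w.
Proof.
move=> Rw; have [n0 gr] := growth Rw; exists n0 => n n0n.
have [M0 lM] := letters_bounded X w n.
pose M := maxn M0 (Num.bound `|cost n w|).
exists M; split; first split => //=.
  apply: le_trans (ler_norm _) _; apply: le_trans (ltW (archi_boundP (normr_ge0 _))) _.
  by rewrite ler_nat leq_maxr.
have lM' i : (i < n)%N -> (nletters X (iter i theta w) <= M)%N.
  by move=> /lM iM; apply: leq_trans iM (leq_maxl _ _).
have := le_trans (gr n n0n) (partition_sum_ab_le reg psi Rw lM').
by rewrite /= lee_fin addrC expRD expRN ler_pdivrMl// expR_gt0.
Qed.

(** The events [E n M] exhaust almost all environments as [M] and then [n] grow,
    so one of them has probability above [1 / 2] with a complement on which the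
    cost is at most [n (t' - t) / 4]; this contradicts [growth_bound]. *)
Lemma no_gap : t' <= t.
Proof.
rewrite leNgt; apply/negP => tt'; pose D := t' - t; have D0 : 0 < D by rewrite subr_gt0.
have [hi [Phi hK hiK]] := base_inverse shift.
have [|delta d0 small] := orbit_sum_small (base_preserving shift) Phi hK ibeta
  (step_cost_ge0 reg t) (e := D / 4); first by rewrite divr_gt0.
pose k := \int[P]_w (kappa w)%:R : R.
have k0 : 0 <= k by exact: Rintegral_ge0.
pose n0 := maxn (N 1%g) (Num.bound (8 * k / D)).
pose c := Num.max (1 - delta) 2^-1.
have c1 : (c%:E < 1)%E by rewrite lte_fin /c gt_max; apply/andP; split; lra.
pose F j := \bigcap_(n in [set n | (j + n0 <= n)%N]) \bigcup_M E n M.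
have mF j : measurable (F j).
  apply: bigcap_measurable; first by exists (j + n0)%N => /=.
  by move=> n _; apply: bigcupT_measurable => M; exact: mE.
have F_mono : {homo F : j j' / (j <= j')%N >-> (j <= j')%O}.
  move=> j j' jj'; apply/subsetPset => w Fw n /= j'n; apply: Fw => /=.
  by apply: leq_trans j'n; rewrite leq_add2r.
have PF : (c%:E < P (\bigcup_j F j))%E.
  have RF : Reg `<=` \bigcup_j F j.
    move=> w /E_ex[j jP]; exists j => // n /= jn.
    by have [M EM] := jP n (leq_trans (leq_addr _ _) jn); exists M.
  have PR : P Reg = 1%E.
    by rewrite -(setCK Reg) probability_setC ?Reg_full ?sube0//; exact: measurableC.
  rewrite -PR in c1; apply: lt_le_trans c1 _; apply: le_measure; rewrite ?inE//.
  exact: bigcupT_measurable.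
have [j] := exists_measure_gt mF F_mono PF.
pose n := (j + n0)%N => cj.
have {cj} PE : (c%:E < P (\bigcup_M E n M))%E.
  apply: lt_le_trans cj _; apply: le_measure; rewrite ?inE//.
    by apply: bigcupT_measurable => M; exact: mE.
  by move=> w Fw; exact: (Fw n (leqnn _)).
have [M cM] := exists_measure_gt (mE n) (@E_mono n) PE.
have n1 : (N 1%g <= n)%N by apply: leq_trans (leq_addl j n0); exact: leq_maxl.
have H : (t' - t) * n%:R * fine (P (E n M)) <= 2 * k + \int[P]_(w in ~` E n M) cost n w.
  apply: (growth_bound shift mphi iphi mkappa ikappa reg mReg ms psi0 m_mean mixing
    green_fin (M := M) (L := M) n1 (mE n M)) => //; [|exact: ltW| |].
  - by move=> w [[]].
  - by move=> w [[]].
  - by move=> w [].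
have PEf : (P (E n M) = (fine (P (E n M)))%:E)%E by rewrite fineK// fin_num_measure.
move: cM; rewrite PEf lte_fin /c gt_max => /andP[cd ch].
have PC : (P (~` E n M) < delta%:E)%E.
  rewrite probability_setC// PEf -EFinB lte_fin; lra.
have sm := small _ n (measurableC (mE n M)) PC.
have nk : 8 * k / D < n%:R.
  apply: (@lt_le_trans _ _ (Num.bound (8 * k / D))%:R).
    by apply: archi_boundP; rewrite divr_ge0 ?mulr_ge0// ltW.
  by rewrite ler_nat; apply: leq_trans (leq_addl j n0); exact: leq_maxr.
have n0' : (0 : R) < n%:R by apply: le_lt_trans nk; rewrite divr_ge0 ?mulr_ge0// ltW.
move: nk; rewrite ltr_pdivrMr// => nk.
have : D * n%:R * 2^-1 <= D * n%:R * fine (P (E n M)).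
  by rewrite ler_wpM2l ?mulr_ge0 ?ltW.
move: H sm nk; rewrite -/D.
have D4 : n%:R * (D / 4) = D * n%:R / 4 by ring.
rewrite D4 [n%:R * D]mulrC; have := mulr_gt0 D0 n0'.
move: (D * n%:R) (D * n%:R * _) (\int[P]_(w in _) _) => x y z.
rewrite -/k; lra.
Qed.

End NoGap.

(** * Reading off the growth rates *)

Section Limits.
Context (R : realType).
Local Open Scope ereal_scope.

Lemma growth_lt (Z : nat -> \bar R) (p : \bar R) (t : R) : (forall n, 0 <= Z n) ->
  (fun n => ((n%:R^-1)%:E * lne (Z n))%E) @ \oo --> p -> p < t%:E ->
  exists n0, forall n, (n0 <= n)%N -> Z n <= (expR (t * n%:R))%:E.
Proof.
move=> Z0 cv pt.
have [n0 _ H] := cv _ (open_ereal_lt' pt).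
exists n0.+1 => n n0n; have n1 : (0 < n%:R :> R)%R by rewrite ltr0n (leq_ltn_trans _ n0n).
have := H n (ltnW n0n); rewrite /= => lt.
rewrite -(lneK (_ : Z n \in `[0, +oo])); last by rewrite in_itv/= leey Z0.
rewrite -[leRHS]/(expeR _%:E) lee_expeR mulrC EFinM.
have nn : n%:R%:E * ((n%:R^-1)%:E * lne (Z n)) = lne (Z n).
  by rewrite muleA -EFinM divff ?mul1e// gt_eqF.
by rewrite -nn; apply: lee_wpmul2l; [rewrite lee_fin ltW|exact: ltW].
Qed.

Lemma growth_gt (Z : nat -> \bar R) (p : \bar R) (t : R) : (forall n, 0 <= Z n) ->
  (fun n => ((n%:R^-1)%:E * lne (Z n))%E) @ \oo --> p -> t%:E < p ->
  exists n0, forall n, (n0 <= n)%N -> (expR (t * n%:R))%:E <= Z n.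
Proof.
move=> Z0 cv pt.
have [n0 _ H] := cv _ (open_ereal_gt' pt).
exists n0.+1 => n n0n; have n1 : (0 < n%:R :> R)%R by rewrite ltr0n (leq_ltn_trans _ n0n).
have := H n (ltnW n0n); rewrite /= => lt.
rewrite -[leRHS](lneK (_ : Z n \in `[0, +oo])); last by rewrite in_itv/= leey Z0.
rewrite -[leLHS]/(expeR _%:E) lee_expeR mulrC EFinM.
have nn : n%:R%:E * ((n%:R^-1)%:E * lne (Z n)) = lne (Z n).
  by rewrite muleA -EFinM divff ?mul1e// gt_eqF.
by rewrite -nn; apply: lee_wpmul2l; [rewrite lee_fin ltW|exact: ltW].
Qed.

Lemma partition_sum_ge0 (d : measure_display) (T : measurableType d) (X : shift_data T) (H : groupType)
    (psi : (nat -> nat) -> H) (phi : T * (nat -> nat) -> R) n a w :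
  0 <= partition_sum X psi phi n a w.
Proof. by apply: esum_ge0 => u _; exact: expeR_ge0. Qed.

Lemma ereal_dense (x y : \bar R) : x < y -> exists t : R, x < t%:E /\ t%:E < y.
Proof.
case: x y => [x| |] [y| |] //=.
- by rewrite lte_fin => xy; exists ((x + y) / 2)%R; rewrite !lte_fin !midf_lt.
- by move=> _; exists (x + 1)%R; rewrite lte_fin ltrDl ltr01 ltry.
- by move=> _; exists (y - 1)%R; rewrite lte_fin gtrBl ltr01 ltNyr.
- by move=> _; exists 0%R; rewrite ltNyr ltry.
Qed.

End Limits.

Lemma visit_time_id (T : Type) (X : shift_data T) a w j :
  (forall n, letter_set X a (iter n (base_map X) w)) -> visit_time X a w j = j.
Proof.
move=> H; elim: j => // j IH; rewrite /visit_time iterS -/(visit_time X a w j) IH.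
apply: (@get_unique _ _ j.+1) => [|n [[jn _] /(_ j.+1) le]].
  by split=> // k [].
by apply/eqP; rewrite eqn_leq jn andbT; apply: le.
Qed.

Lemma ae_forall_countable (R : realType) (d : measure_display) (T : measurableType d)
    (P : probability T R) (I : choiceType) (Q : I -> T -> Prop) :
  countable [set: I] -> (forall i, {ae P, forall w, Q i w}) ->
  {ae P, forall w, forall i, Q i w}.
Proof.
move=> /countable_injP[f finj] aeQ.
have : {ae P, forall w, forall n i, f i = n -> Q i w}.
  apply: ae_forall_nat => n; have [[i <-]|ni] := pselect (exists i, f i = n).
    by apply: filterS (aeQ i) => w Qi j /finj -> //; rewrite inE.
  by apply: aeW => w i fi; case: ni; exists i.
by apply: filterS => w H i; exact: H (f i) i erefl.
Qed.

(** * Regular environments *)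

Lemma point_selection (R : realType) (d : measure_display) (T : measurableType d)
    (P : probability T R) (X : shift_data T) (a N : nat) :
  random_shift_of_finite_type P X -> (0 < N)%N ->
  exists s : T -> nat -> nat, (forall i j, measurable [set w | s w i = j]) /\
    forall w, (forall i, exists u, loop X a (iter i (base_map X) w) u /\ size u = N) ->
      fiber X w (s w) /\ s w 0%N = a.
Proof.
move=> shift N0.
have [|U [UP mU]] := @countable_selection _ T (seq nat) [::]
    (fun u => [set w | (size u == N) /\ loop X a w u]).
  by move=> u; apply: measurable_and_bool; exact: (measurable_loop shift).
exists (fun w i => nth 0%N (U (iter (i %/ N * N) (base_map X) w)) (i %% N)); split.
  move=> i j; apply: (measurable_iter_preimage shift (i %/ N * N)
    (A := [set w | nth 0%N (U w) (i %% N) = j])).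
  exact: (mU [set u | nth 0%N u (i %% N) = j]).
move=> w H; have H' i : loop X a (iter i (base_map X) w) (U (iter i (base_map X) w)) /\
    size (U (iter i (base_map X) w)) = N.
  have [u [lu su]] := H i.
  by have [|/eqP] := UP (iter i (base_map X) w) u; first by split => //; exact/eqP.
split; first exact: (loops_fiber N0 H').
by rewrite div0n mod0n mul0n /=; have [/loopP[]] := H' 0%N.
Qed.

(** The second inclusion provides a point of the cylinder of [u] whose shift is
    [s]; all transitions of the loop are read off from it. *)
Lemma extension_loop (T : Type) (X : shift_data T) a n w u s :
  (0 < n)%N -> fiber X (iter n (base_map X) w) s -> s 0%N = a -> words X n w u ->
  cylinder X w u `<=` cylinder X w [:: a] ->
  cylinder X (iter n (base_map X) w) [:: a] `<=` iter n left_shift @` cylinder X w u ->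
  loop X a w u.
Proof.
move=> n0 fs sa [su au] ua /(_ s)[|y [fy yu] ys]; first by split => // -[].
have [_ /(_ 0%N isT) /= ya] := ua y (conj fy yu).
have yE : y = glue u s.
  apply/funext => i; rewrite /glue; case: ltnP => iu; first exact: yu.
  by rewrite -ys iter_left_shift su subnK// -su.
by apply: (fiber_loop (s := s)); rewrite -?yE// ?su// -ya yu// su.
Qed.

Theorem theorem1p2 (R : realType) (d : measure_display) (T : measurableType d)
    (P : probability T R) (X : shift_data T)
    (G : groupType) (psi : (nat -> nat) -> G)
    (phi : T * (nat -> nat) -> R) (p p_ab : \bar R) :
  random_shift_of_finite_type P X ->
  shift_mixing P X ->
  countable [set: G] ->
  depends_on_first_coordinate psi ->
  extension_mixing P X psi ->
  measurable_fun (total_space X : set (T * sequences)) phi ->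
  locally_fiber_Holder P X phi ->
  P.-integrable [set: T] (fiber_sup_norm X phi) ->
  P.-integrable [set: T] (fun w => lne (transfer_one_norm X phi w)) ->
  amenable R G ->
  is_relative_Gurevic_pressure P X psi phi p ->
  is_relative_Gurevic_pressure P X (fun x => ab_proj (psi x)) phi p_ab ->
  p = p_ab.
Proof.
move=> shift mix cG psi0 emix mphi [kappa [mkappa _ ikappa holder]] iphi _ [m m_mean] Hp Hab.
have [a [ea al]] := least_essential_letter shift.
have [N0 loopsN] := mix a a ea ea.
have /choice[N NP] := fun g => emix a a g ea ea.
have [s [ms sP]] := point_selection a shift (ltn0Sn N0).
have [hi [Phi hK hiK]] := base_inverse shift.
have Pt := base_preserving shift.
have finP : {ae P, forall w, fiber_sup_norm X phi w \is a fin_num}.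
  by have := integrable_ae measurableT iphi; apply: filterS => w; apply.
have aeN := ae_forall_countable cG NP.
(* All almost sure properties are gathered on a single invariant set. *)
have [Reg [mReg Reg_full Reg_inv RegQ]] := ae_invariant_set Pt Phi hK
  (filterI al (filterI loopsN (filterI aeN (filterI holder
     (filterI finP (filterI (Hp a ea) (Hab a ea))))))).
have Reg_iter i w : Reg (iter i (base_map X) w) <-> Reg w.
  by elim: i => // i IH; rewrite iterS Reg_inv.
have Reg_al w i : Reg w -> (a < nletters X (iter i (base_map X) w))%N.
  by move=> /(Reg_iter i)/RegQ[].
have Reg_point w : Reg w -> fiber X w (s w) /\ s w 0%N = a.
  move=> Rw; apply: sP => i; have Ri := (Reg_iter i w).2 Rw.
  have [_ [Q _]] := RegQ _ Ri.
  have [u lu] := Q N0.+1 (leqnSn _) (Reg_al w i Rw) (Reg_al _ N0.+1 Ri).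
  have su : size u = N0.+1 by case: lu => -[].
  by exists u; split => //; rewrite /loop su.
have Reg_letter w i : Reg w -> letter_set X a (iter i (base_map X) w).
  move=> Rw; have [fs sa] := Reg_point _ ((Reg_iter i w).2 Rw).
  by exists (s (iter i (base_map X) w)); split => // -[].
have reg : regular_set X phi kappa a s Reg.
  by split => // w /RegQ[_ [_ [_ [hw [fw _]]]]].
pose N' g := maxn (N g) 1.
have mixing x n w : Reg w -> (N' x <= n)%N ->
    exists u, [/\ loop X a w u, size u = n & cocycle_word psi u = x].
  rewrite geq_max => Rw /andP[xn n0]; have [_ [_ [Q _]]] := RegQ w Rw.
  have [u [wu cu uc ux]] := Q x n xn (Reg_al w 0%N Rw) (Reg_al w n Rw).
  have [fs sa] := Reg_point _ ((Reg_iter n w).2 Rw).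
  exists u; split => //; last by case: wu.
  exact: extension_loop n0 fs sa wu cu uc.
have visit w j : Reg w -> visit_time X a w j = j.
  by move=> Rw; apply: visit_time_id => n; exact: Reg_letter.
have cvp w : Reg w -> (fun n => ((n%:R^-1)%:E * lne (partition_sum X psi phi n a w))%E)
    @ \oo --> p.
  move=> Rw; have [_ [_ [_ [_ [_ [/(_ (Reg_letter w 0%N Rw)) + _]]]]]] := RegQ w Rw.
  by under eq_fun do rewrite visit//.
have cvab w : Reg w -> (fun n => ((n%:R^-1)%:E *
    lne (partition_sum X (fun x => ab_proj (psi x)) phi n a w))%E) @ \oo --> p_ab.
  move=> Rw; have [_ [_ [_ [_ [_ [_ /(_ (Reg_letter w 0%N Rw))]]]]]] := RegQ w Rw.
  by under eq_fun do rewrite visit//.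
apply/eqP; rewrite eq_le; apply/andP; split.
  rewrite leNgt; apply/negP => /ereal_dense[t [abt /ereal_dense[t' [tt' tp]]]].
  have [w Rw] : exists w, Reg w.
    apply: contrapT => /forallNP nR; move: Reg_full.
    rewrite (_ : ~` Reg = setT); last by apply/seteqP; split=> // w _; exact: nR.
    by rewrite probability_setT => -[/eqP]; rewrite oner_eq0.
  have [n1 le1] := growth_lt (fun n => partition_sum_ge0 X _ phi n a w) (cvab w Rw) abt.
  have [n2 le2] := growth_gt (fun n => partition_sum_ge0 X _ phi n a w) (cvp w Rw) tp.
  pose n := (maxn n1 n2).+1.
  have le12 : (partition_sum X psi phi n a w <=
      partition_sum X (fun x => ab_proj (psi x)) phi n a w)%E.
    apply: esum_subset => u [lu cu]; split => //; apply/(cocycle_word_ab1 psi).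
    by rewrite cu; case: (commutator_subgroupP G).
  have := le_trans (le2 n (leqW (leq_maxr _ _))) (le_trans le12 (le1 n (leqW (leq_maxl _ _)))).
  by rewrite lee_fin ler_expR ler_pM2r ?ltr0n// -lee_fin leNgt tt'.
rewrite leNgt; apply/negP => /ereal_dense[t [/ereal_dense[t1 [pt1]]]].
rewrite lte_fin => t1t /ereal_dense[t' [tt' t'ab]].
have green1 w : Reg w -> (green X phi a s psi t 1%g w < +oo)%E.
  move=> Rw; have [n0 le0] := growth_lt (fun n => partition_sum_ge0 X _ phi n a w) (cvp w Rw) pt1.
  exact: (green1_fin reg Rw t1t le0).
(* A loop with product [g^-1] from [n] steps earlier compares [green g] with
   [green 1]. *)
have green_fin g w : Reg w -> (green X phi a s psi t g w < +oo)%E.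
  move=> Rw; pose n := N' (g^-1)%g; pose w0 := iter n hi w.
  have w0E : iter n (base_map X) w0 = w.
    by rewrite /w0; elim: (n) => // k IH; rewrite iterSr /= hiK.
  have Rw0 : Reg w0 by apply/(Reg_iter n); rewrite w0E.
  have [u [lu su cu]] := mixing (g^-1)%g n w0 Rw0 (leqnn _).
  have := green_step reg psi0 t 1%g Rw0 lu.
  rewrite su w0E cu invgK mulg1 => /le_lt_trans/(_ (green1 w0 Rw0)).
  case: (green X phi a s psi t g w) (green_ge0 X phi a s psi t g w) => [r| |]//.
  - by move=> _ _; exact: ltry.
  - rewrite gt0_muley ?ltxx// lte_fin mulr_gt0 ?expR_gt0//.
    by rewrite loop_termE// mulr_gt0 ?expR_gt0.
move: tt'; rewrite lte_fin ltNge => /negP; apply.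
apply: (no_gap shift mphi iphi mkappa ikappa reg mReg Reg_full ms psi0 m_mean mixing
  green_fin) => w Rw.
exact: growth_gt (fun n => partition_sum_ge0 X _ phi n a w) (cvab w Rw) t'ab.
Qed.
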